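(* For integers $m\geq2$, $\ell\geq1$, $\delta=p^{-\ell}$, and $f\in L^m(\mathbb Z_p^m)$, define for $u\in\mathbb Z_p^{m-1}$ $$\mathcal K_\delta f(u)=\sup_{w\in\mathbb Z_p^{m-1}}\int_{\mathbb Z_p}\frac1{\delta^{m-1}}\int_{B(w+tu,\delta)}|f(t,z)|\,dz\,dt.$$ There is a constant $C_{p,m}$ depending only on $p$ and $m$ such that for every $m\geq2$, $\ell\geq1$ and $f\in L^m(\mathbb Z_p^m)$, $$\|\mathcal K_{p^{-\ell}}f\|_{L^m(\mathbb Z_p^{m-1})}\leq C_{p,m}(\ell+1)^2\|f\|_{L^m(\mathbb Z_p^m)}.$$ In particular, for every $\varepsilon>0$ there is a constant $C_{p,m,\varepsilon}$ depending only on $p,m,\varepsilon$ such that, with $\delta=p^{-\ell}$, $$\|\mathcal K_\delta f\|_{L^m(\mathbb Z_p^{m-1})}\leq C_{p,m,\varepsilon}\,\delta^{-\varepsilon}\|f\|_{L^m(\mathbb Z_p^m)}.$$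
   Context: $p$ is a fixed prime and $|p|_p=p^{-1}$. $\mathbb Q_p^k$ carries the supremum norm; $B(x,\rho)=\{y:\|y-x\|\leq\rho\}$ is the closed ball (here in $\mathbb Q_p^{m-1}$). Integrals and $L^m$ norms on $\mathbb Z_p^k$ are with respect to Haar measure normalized so that $\mathbb Z_p^k$ has measure $1$. Points of $\mathbb Z_p^m$ are written $(t,z)$ with $t\in\mathbb Z_p$, $z\in\mathbb Z_p^{m-1}$. *)

(* Defs.v *)
From HB Require Import structures.
From mathcomp Require Import all_boot all_order all_algebra.
From mathcomp Require Import complex.
From mathcomp Require Import all_classical all_reals all_analysis.

Set Implicit Arguments.
Unset Strict Implicit.
Unset Printing Implicit Defensive.

Import Order.TTheory GRing.Theory Num.Theory.

Local Open Scope classical_set_scope.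
Local Open Scope ring_scope.

(* The p-adic integers as the inverse limit of the rings Z/p^n: x n is the
   representative in [0, p^n) of the residue of x modulo p^n. (The ring axioms
   hold for every p; the elements are the p-adic integers when p is prime.) *)
Record padic_int (p : nat) := PadicInt {
  residue :> nat -> int;
  residue_compat : forall n, (residue n = (residue n.+1 %% p%:Z ^+ n)%Z)%R
}.

HB.instance Definition _ (p : nat) := gen_eqMixin (padic_int p).
HB.instance Definition _ (p : nat) := gen_choiceMixin (padic_int p).

Section PadicRing.
Variable p : nat.
Implicit Types x y z : padic_int p.

Lemma padic_eqP x y : (forall n, x n = y n) -> x = y.
Proof.
case: x y => [x cx] [y cy] /= xy.
have exy : x = y by apply/funext.
by subst y; congr PadicInt; exact: Prop_irrelevance.
Qed.

Lemma modz_pexpS (a : int) n :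
  ((a %% p%:Z ^+ n.+1)%Z = a %[mod p%:Z ^+ n])%Z.
Proof.
apply/eqP; rewrite eqz_mod_dvd {2}(divz_eq a (p%:Z ^+ n.+1)) opprD addrCA.
by rewrite subrr addr0 rpredN exprSr mulrCA dvdz_mulr.
Qed.

Lemma residue_mod x n : (x n = x n.+1 %[mod p%:Z ^+ n])%Z.
Proof. by rewrite [X in (X %% _)%Z]residue_compat modz_mod. Qed.

Lemma residue_small x n : (x n %% p%:Z ^+ n)%Z = x n.
Proof. by rewrite residue_compat modz_mod. Qed.

Section OfCompatible.
Variable a : nat -> int.
Hypothesis ca : forall n, (a n = a n.+1 %[mod p%:Z ^+ n])%Z.

Lemma padic_of_compat n :
  ((a n %% p%:Z ^+ n) = (a n.+1 %% p%:Z ^+ n.+1)%Z %% p%:Z ^+ n)%Z.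
Proof. by rewrite modz_pexpS ca. Qed.

Definition padic_of : padic_int p :=
  @PadicInt p (fun n => (a n %% p%:Z ^+ n)%Z) padic_of_compat.

End OfCompatible.

Lemma padic_add_compat x y n :
  (x n + y n = x n.+1 + y n.+1 %[mod p%:Z ^+ n])%Z.
Proof. by rewrite -modzDm !residue_mod modzDm. Qed.

Lemma padic_mul_compat x y n :
  (x n * y n = x n.+1 * y n.+1 %[mod p%:Z ^+ n])%Z.
Proof. by rewrite -modzMm !residue_mod modzMm. Qed.

Lemma padic_opp_compat x n : (- x n = - x n.+1 %[mod p%:Z ^+ n])%Z.
Proof. by rewrite -modzNm residue_mod modzNm. Qed.

Definition padic_zero : padic_int p := @padic_of (fun=> 0) (fun=> erefl).
Definition padic_one : padic_int p := @padic_of (fun=> 1) (fun=> erefl).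
Definition padic_add x y := padic_of (padic_add_compat x y).
Definition padic_mul x y := padic_of (padic_mul_compat x y).
Definition padic_opp x := padic_of (padic_opp_compat x).

Lemma padic_addA : associative padic_add.
Proof. by move=> x y z; apply: padic_eqP => n /=; rewrite modzDml modzDmr addrA. Qed.

Lemma padic_addC : commutative padic_add.
Proof. by move=> x y; apply: padic_eqP => n /=; rewrite addrC. Qed.

Lemma padic_add0 : left_id padic_zero padic_add.
Proof. by move=> x; apply: padic_eqP => n /=; rewrite modzDml add0r residue_small. Qed.

Lemma padic_addN : left_inverse padic_zero padic_opp padic_add.
Proof. by move=> x; apply: padic_eqP => n /=; rewrite modzDml addNr. Qed.

HB.instance Definition _ := GRing.isZmodule.Build (padic_int p)
  padic_addA padic_addC padic_add0 padic_addN.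

Lemma padic_mulA : associative padic_mul.
Proof. by move=> x y z; apply: padic_eqP => n /=; rewrite modzMml modzMmr mulrA. Qed.

Lemma padic_mulC : commutative padic_mul.
Proof. by move=> x y; apply: padic_eqP => n /=; rewrite mulrC. Qed.

Lemma padic_mul1 : left_id padic_one padic_mul.
Proof. by move=> x; apply: padic_eqP => n /=; rewrite modzMml mul1r residue_small. Qed.

Lemma padic_mulDl : left_distributive padic_mul +%R.
Proof.
move=> x y z; apply: padic_eqP => n /=.
by rewrite modzMml mulrDl modzDm.
Qed.

HB.instance Definition _ := GRing.Zmodule_isComPzRing.Build (padic_int p)
  padic_mulA padic_mulC padic_mul1 padic_mulDl.

HB.instance Definition _ := isPointed.Build (padic_int p) 0.

(* The p-adic topology: the cosets x + p^n Z_p form a base of neighbourhoods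
   of x. *)
Definition padic_open (U : set (padic_int p)) :=
  forall x, U x -> exists n, [set y : padic_int p | y n = x n] `<=` U.

Lemma padic_openT : padic_open setT.
Proof. by move=> x _; exists 0%N. Qed.

Lemma residue_le x y m n : (m <= n)%N -> x n = y n -> x m = y m.
Proof.
elim: n => [|n IHn]; first by rewrite leqn0 => /eqP ->.
rewrite leq_eqVlt => /predU1P[-> //|]; rewrite ltnS => /IHn{}IHn xy.
by apply: IHn; rewrite residue_compat xy -residue_compat.
Qed.

Lemma padic_openI : setI_closed padic_open.
Proof.
move=> U V oU oV x [/oU[m Um] /oV[n Vn]]; exists (maxn m n) => y /= yx.
split; [apply: Um|apply: Vn]; apply: residue_le yx.
- exact: leq_maxl.
- exact: leq_maxr.
Qed.

Lemma padic_open_bigU (I : Type) (F : I -> set (padic_int p)) :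
  (forall i, padic_open (F i)) -> padic_open (\bigcup_i F i).
Proof. by move=> oF x [i _ /oF[n Fn]]; exists n => y /Fn ?; exists i. Qed.

HB.instance Definition _ := isOpenTopological.Build (padic_int p)
  padic_openT padic_openI padic_open_bigU.

End PadicRing.

Section BorelSets.
Variable T : ptopologicalType.
Definition borel : set (set T) := <<s [set U : set T | open U] >>.

Lemma borel0 : borel set0.
Proof. exact: sigma_algebra0. Qed.

Lemma borelC A : borel A -> borel (~` A).
Proof. exact: sigma_algebraC. Qed.

Lemma borel_bigcup (F : (set T)^nat) :
  (forall i, borel (F i)) -> borel (\bigcup_i F i).
Proof. exact: sigma_algebra_bigcup. Qed.
End BorelSets.

HB.instance Definition _ (p : nat) :=
  @isMeasurable.Build default_measure_display (padic_int p) _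
    (@borel0 (padic_int p)) (@borelC (padic_int p))
    (@borel_bigcup (padic_int p)).

(* Z_p^k, with the product topology of matrices. *)
HB.instance Definition _ (p k : nat) :=
  @isMeasurable.Build default_measure_display 'rV[padic_int p]_k _
    (@borel0 'rV[padic_int p]_k) (@borelC 'rV[padic_int p]_k)
    (@borel_bigcup 'rV[padic_int p]_k).

(* On a compact group (G, add), the Haar measure of total mass 1 is the unique Borel
   probability measure that is invariant under translations. On a product of
   second countable groups the product sigma-algebra, which is the one the
   library puts on a product, is the Borel sigma-algebra. *)
Definition normalized_haar d (G : measurableType d) (R : realType)
    (mu : probability G R) (add : G -> G -> G) :=
  forall (g : G) (A : set G), measurable A ->
    mu [set add g x | x in A] = mu A.

Section Norms.
Variables (R : realType) (p : nat).

(* |x|_p = p^-v for v the largest n with p^n | x, and |0|_p = 0. *)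
Definition padic_norm (x : padic_int p) : R :=
  inf [set (p%:R ^- n : R) | n in [set n | x n = 0]].

Definition sup_norm k (x : 'rV[padic_int p]_k) : R :=
  \big[Num.max/0]_(i < k) padic_norm (x 0 i).

Definition padic_ball k (x : 'rV[padic_int p]_k) (r : R) :=
  [set y : 'rV[padic_int p]_k | sup_norm (y - x) <= r].

End Norms.

(* The space Z_p^m of the points (t, z), for 0 < m. *)
Notation padic_space p m := (padic_int p * 'rV[padic_int p]_m.-1)%type.

Definition complex_Lfun d (T : measurableType d) (R : realType)
    (mu : {measure set T -> \bar R}) (q : \bar R) (f : T -> R[i]) :=
  (fun x => complex.Re (f x)) \in Lfun mu q /\
  (fun x => complex.Im (f x)) \in Lfun mu q.

Definition cmod (R : realType) (z : R[i]) : R := ComplexField.Normc.normc z.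

Section Kakeya.
Variables (R : realType) (p m : nat).
Variables (mu1 : probability (padic_int p) R).
Variables (mu : probability 'rV[padic_int p]_m.-1 R).
Local Open Scope ereal_scope.

Definition kakeya_maximal (delta : R) (f : padic_space p m -> R[i])
    (u : 'rV[padic_int p]_m.-1) : \bar R :=
  ereal_sup [set \int[mu1]_t ((delta ^- m.-1)%:E *
                 \int[mu]_(z in padic_ball (w + t *: u)%R delta)
                   (cmod (f (t, z)))%:E) | w in [set: 'rV[padic_int p]_m.-1]].

End Kakeya.

(* Main.v *)
Require Import Defs.
From mathcomp Require Import all_boot all_order all_algebra all_field.
From mathcomp Require Import complex.
From mathcomp Require Import all_classical all_reals all_analysis.
From mathcomp Require Import measurable_realfun.
From mathcomp Require Import zify ring.

Set Implicit Arguments.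
Unset Strict Implicit.
Unset Printing Implicit Defensive.

Import Order.TTheory GRing.Theory Num.Theory.

Local Open Scope ring_scope.

(* Put N = p^l and m = k+1. Averaging |f| over the residue classes modulo N turns
   the estimate into one for functions F on (Z/N)^m, and cutting F into the l
   levels M p^-(j+1) < F, with M = max F, reduces it to the counting bound
     sum_u r_u^m <= m^m l^k N^k |S|,    r_u = |S meets {(t, w_u + t u)}|,
   for a set S of points.

   For the counting bound, let zeta be a complex primitive N-th root of unity and
   attach to a point x the character y |-> zeta^<x,y>. The r points of S on a line
   of direction (1, u) span, by divided differences, functions with values in
   Z[zeta] that reduce modulo the prime above p, where zeta becomes 1, to the
   binomials C(<(1,u),y>, j), j < r. Ranks only drop under reduction, so |S| is at
   least the rank over F_p of the rows (u, j), j < r_u. The shears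
   (t, z) |-> (t, z + t c) move all directions by c without changing |S|;
   averaging over c the number of elements of a basis chosen greedily by
   increasing j gives N^k |S| >= sum_u rank {(v, j) : j < r_u, v any direction}.
   Finally the columns y with y_0 + l (y_1 + ... + y_k) < r of the matrix of all
   rows with j < r are independent: a relation among them is a polynomial in Y
   and Y^(u_1), ..., Y^(u_k) divisible by (Y - 1)^r for all u, and q-differences
   in the u_i isolate each coefficient at the cost of the order at Y = 1 of
   prod_(i < a) (Y^a - Y^i), which is at most a l. *)

(** * Polynomials vanishing to high order at 1 *)

(** After reversal the terms are p^v(i) for 1 <= i <= a, with v(i) < l. Each is at most the sum of
    the p^v, v < l, dividing i, and for fixed v these add up to at most a. *)
Lemma sum_pfactor_le p l a : prime p -> (a < p ^ l)%N ->
  (\sum_(i < a) p ^ logn p (a - i) <= a * l)%N.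
Proof.
move=> p_pr al.
rewrite (reindex_inj rev_ord_inj) /=.
under eq_bigr => i _ do rewrite subKn //.
rewrite -(big_mkord xpredT (fun i => p ^ logn p i.+1)%N).
have bnd i : (i < a)%N -> (p ^ logn p i.+1 <= \sum_(v < l) p ^ v * (p ^ v %| i.+1))%N.
  move=> ia; have vl : (logn p i.+1 < l)%N.
    rewrite -(ltn_exp2l _ _ (prime_gt1 p_pr)); apply: leq_ltn_trans al.
    by apply: leq_trans ia; rewrite dvdn_leq // pfactor_dvdnn.
  by rewrite (bigD1 (Ordinal vl)) //= pfactor_dvdnn muln1 leq_addr.
rewrite big_mkord (leq_trans (leq_sum _ (fun (i : 'I_a) _ => bnd i (ltn_ord i)))) //.
rewrite exchange_big /= mulnC -[l in (l * a)%N]card_ord -sum_nat_const leq_sum // => v _.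
rewrite -big_distrr /= -(big_mkord xpredT (fun i => (p ^ v %| i.+1 : nat)))%N.
rewrite -(big_add1 _ _ 0 a.+1 xpredT (fun i => (p ^ v %| i : nat))) -divn_count_dvd.
by rewrite mulnC leq_trunc_div.
Qed.

Section RootAtOne.
Variables (F : fieldType) (p : nat).
Hypothesis charF : p \in [pchar F].
Local Notation X1 := ('X - 1 : {poly F}).

Let p_pr : prime p. Proof. by case/andP: charF. Qed.

(** For n = n' q with q = p^v and p prime to n', Frobenius gives X^n - 1 = (X^n' - 1)^q; the
    cofactor of X - 1 in X^n' - 1 takes the value n' <> 0 at 1. *)
Lemma Xn_sub1_factor n : (0 < n)%N ->
  exists2 h : {poly F}, 'X^n - 1 = X1 ^+ (p ^ logn p n) * h & h.[1] != 0.
Proof.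
move=> n0; have [n' pn' nE] := pfactor_coprime p_pr n0.
set q := (p ^ logn p n)%N in nE *.
have charP : p \in [pchar {poly F}] by rewrite pchar_poly.
have qnat : [pchar {poly F}].-nat q.
  by rewrite (eq_pnat _ (pcharf_eq charP)) pnatX pnat_id.
exists ((\sum_(i < n') 'X^i) ^+ q); last first.
  rewrite horner_exp expf_neq0 // horner_sum.
  under eq_bigr do rewrite hornerXn expr1n.
  rewrite sumr_const card_ord -(dvdn_pcharf charF) -prime_coprime //.
rewrite -exprMn -subrX1 exprDn_pchar // exprNn_pchar // expr1n -exprM.
by rewrite -nE.
Qed.

Lemma X1_coprime (h : {poly F}) n : h.[1] != 0 -> coprimep (X1 ^+ n) h.
Proof.
move=> h1; rewrite coprimep_expl // -polyC1 coprimep_sym coprimep_XsubC //.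
Qed.

(** As X^a - X^i = X^i (X^(a-i) - 1), this factor vanishes at 1 to order exactly p^v, with v the
    valuation of a - i. *)
Lemma dvdp_X1_diff r (g : {poly F}) a i : (i < a)%N ->
  X1 ^+ r %| g * ('X^a - 'X^i) -> X1 ^+ (r - p ^ logn p (a - i)) %| g.
Proof.
move=> ia; have ai : (0 < a - i)%N by rewrite subn_gt0.
have [h hE h1] := Xn_sub1_factor ai.
have -> : 'X^a - 'X^i = X1 ^+ (p ^ logn p (a - i)) * (h * 'X^i) :> {poly F}.
  by rewrite mulrA -hE mulrBl -exprD subnK ?mul1r // ltnW.
set q := (p ^ _)%N.
have [rq|qr] := leqP r q; first by rewrite (eqP rq) expr0 dvd1p.
rewrite -{1}(subnK (ltnW qr)) exprD mulrCA [X in X %| _]mulrC.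
rewrite dvdp_mul2l; last by rewrite expf_neq0 // -polyC1 polyXsubC_eq0.
rewrite Gauss_dvdpl //; apply: X1_coprime.
by rewrite hornerM hornerXn expr1n mulr1.
Qed.

Lemma dvdp_X1_prod r (g : {poly F}) a n : (n <= a)%N ->
  X1 ^+ r %| g * \prod_(i < n) ('X^a - 'X^i) ->
  X1 ^+ (r - \sum_(i < n) p ^ logn p (a - i)) %| g.
Proof.
elim: n g => [|n IHn] g na; first by rewrite !big_ord0 mulr1 subn0.
rewrite !big_ord_recr /= mulrA mulrAC => /(IHn _ (ltnW na)) /(dvdp_X1_diff na).
by rewrite subnDA.
Qed.

End RootAtOne.

(* The operators s |-> s(_ + 1) - q^i s kill the geometric sequences of ratio
   q^i. *)
Fixpoint qdiff (R : pzRingType) (q : R) (a : nat) (s : nat -> R) (n : nat) : R :=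
  if a is a'.+1 then qdiff q a' s n.+1 - q ^+ a' * qdiff q a' s n else s n.

(** Each n |-> q^(n b) is an eigenvector of the shift with eigenvalue q^b; its factor is zero for b
    < a. *)
Lemma qdiff_geometric (R : comPzRingType) (q : R) a (I : finType) (c : I -> R)
    (b : I -> nat) n :
  qdiff q a (fun n => \sum_i c i * q ^+ (n * b i)) n =
  \sum_i c i * q ^+ (n * b i) * \prod_(j < a) (q ^+ b i - q ^+ j).
Proof.
elim: a n => [|a IHa] n /=.
  by under [RHS]eq_bigr do rewrite big_ord0 mulr1.
rewrite !IHa mulr_sumr -sumrB; apply: eq_bigr => i _.
by rewrite big_ord_recr /= mulSn exprD; ring.
Qed.

Lemma dvdp_qdiff (F : fieldType) (q d : {poly F}) a s n :
  (forall i, (i <= a)%N -> d %| s (n + i)%N) -> d %| qdiff q a s n.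
Proof.
elim: a n => [|a IHa] n ds /=; first by have := ds 0 (leqnn _); rewrite addn0.
apply: dvdp_sub; first by apply: IHa => i ia; rewrite addSnnS ds.
by apply: dvdp_mull; apply: IHa => i ia; rewrite ds // leqW.
Qed.

(** * Residue vectors and independence of columns *)

Section ResidueRows.
Variables (p l : nat).
Hypotheses (p_pr : prime p) (l_gt0 : (0 < l)%N).
Local Notation Z := 'Z_(p ^ l).

Definition dotn k (u y : 'rV[Z]_k) : nat := \sum_(i < k) u 0%R i * y 0%R i.
Definition wt k (y : 'rV[Z]_k) : nat := \sum_(i < k) y 0%R i.

Lemma pl_gt1 : (1 < p ^ l)%N.
Proof. by rewrite -(exp1n l) ltn_exp2r // prime_gt1. Qed.

Lemma Z_lt (a : Z) : (a < p ^ l)%N.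
Proof. by rewrite -{2}(Zp_cast pl_gt1) ltn_ord. Qed.

Lemma row_mx_hd_tl k (y : 'rV[Z]_(1 + k)) :
  row_mx (const_mx (lsubmx y 0 0) : 'rV_1) (rsubmx y) = y.
Proof.
rewrite -[RHS]hsubmxK; congr (row_mx _ _).
by apply/rowP => i; rewrite !mxE !ord1.
Qed.

Lemma big_rV_recl k (V : nmodType) (h : 'rV[Z]_k.+1 -> V) :
  \sum_y h y = \sum_a \sum_y h (row_mx (const_mx a : 'rV_1) y).
Proof.
rewrite pair_bigA /= (reindex (fun q : Z * 'rV[Z]_k =>
  row_mx (const_mx q.1 : 'rV_1) q.2 : 'rV_k.+1)) //=.
exists (fun y : 'rV_(1 + k) => (lsubmx y 0 0, rsubmx y)) => [[a y]|y] _ /=.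
  by rewrite row_mxKl row_mxKr mxE.
exact: row_mx_hd_tl.
Qed.

Lemma dotn_row k (u y : 'rV[Z]_k) (a b : Z) :
  dotn (row_mx (const_mx a : 'rV_1) u : 'rV_k.+1) (row_mx (const_mx b : 'rV_1) y) =
  (a * b + dotn u y)%N.
Proof.
suff: @dotn (1 + k) (row_mx (const_mx a) u) (row_mx (const_mx b) y) =
  (a * b + dotn u y)%N by [].
rewrite /dotn big_split_ord big_ord1 /= !row_mxEl !mxE; congr addn.
by apply: eq_bigr => i _; rewrite !row_mxEr.
Qed.

Lemma wt_row k (y : 'rV[Z]_k) (b : Z) :
  wt (row_mx (const_mx b : 'rV_1) y : 'rV_k.+1) = (b + wt y)%N.
Proof.
suff: @wt (1 + k) (row_mx (const_mx b) y) = (b + wt y)%N by [].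
rewrite /wt big_split_ord big_ord1 /= !row_mxEl !mxE; congr addn.
by apply: eq_bigr => i _; rewrite !row_mxEr.
Qed.

End ResidueRows.

Section Independence.
Variables (F : fieldType) (p l : nat).
Hypotheses (charF : p \in [pchar F]) (l_gt0 : (0 < l)%N).
Let p_pr : prime p. Proof. by case/andP: charF. Qed.
Local Notation X1 := ('X - 1 : {poly F}).
Local Notation Z := 'Z_(p ^ l).

(** With q = X, the a-fold q-difference in u at 0 kills the terms b < a, and those with b > a vanish
    by hypothesis. What is left is c a times prod_(i < a) (X^a - X^i), whose order at 1 is at most a
    l. *)
Lemma dvdp_X1_top r (c : Z -> {poly F}) (a : Z) :
  (forall b : Z, (a < b)%N -> c b = 0) ->
  (forall u : Z, X1 ^+ r %| \sum_b c b * 'X^(u * b)) ->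
  X1 ^+ (r - l * a) %| c a.
Proof.
move=> ca cu.
have : X1 ^+ r %| qdiff 'X a (fun n => \sum_b c b * 'X^(n * b)) 0%N.
  apply: dvdp_qdiff => i ia; rewrite add0n.
  have iN : (i < (Zp_trunc (p ^ l)).+2)%N by rewrite (leq_ltn_trans ia).
  exact: cu (Ordinal iN).
rewrite qdiff_geometric (bigD1 a) //= addrC big1 ?add0r ?mul0n ?expr0 ?mulr1; last first.
  move=> b ba; have [ab|] := ltnP a b; first by rewrite ca // !mul0r.
  rewrite leq_eqVlt (inj_eq val_inj) (negPf ba) /= => {}ba.
  by rewrite (bigD1 (Ordinal ba)) //= subrr mul0r mulr0.
move/(dvdp_X1_prod charF (leqnn _)); apply: dvdp_trans.
by rewrite dvdp_exp2l // leq_sub2l // mulnC sum_pfactor_le // (Z_lt p_pr l_gt0).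
Qed.

(** Induction on k, splitting off the first coordinate: for each of its values a, [dvdp_X1_top]
    yields the hypotheses of the case k with r - l a in place of r. *)
Lemma X1_independent k r (g : 'rV[Z]_k -> {poly F}) :
  (forall y, (size (g y) <= r - l * wt y)%N) ->
  (forall u, X1 ^+ r %| \sum_y g y * 'X^(dotn u y)) ->
  forall y, g y = 0.
Proof.
elim: k r g => [|k IHk] r g gs gu y.
  (* For k = 0, a nonzero multiple of (X - 1)^r has size at least r + 1, beyond the allowed r. *)
  have := gu 0; rewrite (bigD1 y) //= big1 ?addr0; last first.
    by move=> y'; rewrite (thinmx0 y') (thinmx0 y) eqxx.
  rewrite /dotn big_ord0 mulr1 => dv; apply/eqP; apply: contraTT (gs y) => g0.
  rewrite -ltnNge /wt big_ord0 muln0 subn0.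
  have := dvdp_leq g0 dv.
  by rewrite -polyC1 size_exp_XsubC.
pose G a y' := g (row_mx (const_mx a : 'rV_1) y').
suff G0 a y' : G a y' = 0.
  by rewrite -(row_mx_hd_tl (y : 'rV_(1 + k))); exact: G0.
(* Downward induction on a, so that the blocks with first coordinate b > a are already known to
   vanish. *)
have [n] := ubnP (p ^ l - a)%N; elim: n a y' => // n IHn a y' an.
apply: (IHk (r - l * a)%N (G a)) => [{}y'|u].
  by have := gs (row_mx (const_mx a : 'rV_1) y'); rewrite wt_row mulnDr subnDA.
have := @dvdp_X1_top r (fun a => \sum_y' G a y' * 'X^(dotn u y')) a.
apply => [b ab|u0].
  rewrite big1 // => i _; rewrite IHn ?mul0r //.
  by have := Z_lt p_pr l_gt0 a; have := Z_lt p_pr l_gt0 b; lia.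
have := gu (row_mx (const_mx u0 : 'rV_1) u); rewrite big_rV_recl.
congr (_ %| _); apply: eq_bigr => b _; rewrite mulr_suml; apply: eq_bigr => i _.
by rewrite dotn_row addnC exprD mulrA.
Qed.

End Independence.

(** * Ranks of matrices *)

Section Rank.

(** A nonzero minor of maximal size over K is the image of a determinant over D; since f vanishes on
    the kernel of g, that determinant is nonzero over L too. *)
Lemma rank_specialize (D : comNzRingType) (K L : fieldType) (f : {rmorphism D -> K})
    (g : {rmorphism D -> L}) a b (A : 'M[D]_(a, b)) :
  (forall x, g x = 0 -> f x = 0) -> (\rank (map_mx f A) <= \rank (map_mx g A))%N.
Proof.
move=> gf; set r := \rank _.
pose I := maxrankfun (map_mx f A).
have full : row_full (rowsub I (map_mx f A))^T.
  by rewrite /row_full mxrank_tr; exact: maxrowsub_free.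
pose J := fullrankfun full.
pose B := \matrix_(i, j) A (I j) (J i) : 'M[D]_r.
have : map_mx f B \in unitmx.
  have := fullrowsub_unit full; congr (_ \in unitmx).
  by apply/matrixP => i j; rewrite !mxE.
rewrite unitmxE det_map_mx unitfE => fB.
have gB : map_mx g B \in unitmx.
  rewrite unitmxE det_map_mx unitfE; apply: contra_neq fB; exact: gf.
rewrite -(mxrank_unit gB) -[leqRHS]mxrank_tr.
have -> : map_mx g B = rowsub J (map_mx g A)^T *m colsub I 1%:M.
  apply/matrixP => i j; rewrite !mxE (bigD1 (I j)) //= big1 => [|k kj].
    by rewrite !mxE eqxx mulr1 addr0.
  by rewrite !mxE (negPf kj) mulr0.
rewrite (leq_trans (mxrankM_maxl _ _)) // rowsubE mxrankM_maxr //.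
Qed.

Variable K : fieldType.

Lemma rank_ge_free_cols a b (W : 'M[K]_(a, b)) (A : {set 'I_b}) :
  (forall c : 'cV_b, (forall i, i \notin A -> c i 0 = 0) -> W *m c = 0 -> c = 0) ->
  (#|A| <= \rank W)%N.
Proof.
move=> free.
pose E := rowsub (enum_val : 'I_#|A| -> _) (1%:M : 'M[K]_b).
suff /eqP <- : row_free (E *m W^T).
  by rewrite -(mxrank_tr W) mxrankM_maxr.
have EE : E *m E^T = 1%:M.
  rewrite {1}/E mul_rowsub_mx mul1mx; apply/matrixP => i j; rewrite !mxE eq_sym.
  by rewrite (inj_eq enum_val_inj).
rewrite -kermx_eq0; apply/rowV0P => x /sub_kermxP; rewrite mulmxA => xW.
suff xE : (x *m E)^T = 0.
  by rewrite -[x]mulmx1 -EE mulmxA -[x *m E]trmxK xE trmx0 mul0mx.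
apply: free => [i iA|]; last by rewrite -[LHS]trmxK trmx_mul trmxK xW trmx0.
rewrite !mxE big1 // => j _; rewrite !mxE; case: eqP => [ji|]; rewrite ?mulr0 //.
by rewrite -ji enum_valP in iA.
Qed.

Variables (q : nat) (v : nat -> 'rV[K]_q).

Definition prefix_span (J : pred nat) n := (\sum_(i < n | J i) <<v i>>)%MS.
Definition pivot n := ~~ (v n <= prefix_span xpredT n)%MS.

Lemma prefix_span_recr J n :
  prefix_span J n.+1 = (if J n then prefix_span J n + <<v n>> else prefix_span J n)%MS.
Proof.
rewrite /prefix_span big_mkcond big_ord_recr -big_mkcond /=.
by case: (J n) => //; rewrite addsmx0_id.
Qed.

Lemma rank_prefix_span_le n :
  (\rank (prefix_span xpredT n) <= \sum_(i < n) pivot i)%N.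
Proof.
elim: n => [|n IHn]; first by rewrite /prefix_span !big_ord0 mxrank0.
rewrite prefix_span_recr big_ord_recr /=; have [vn|vn] := boolP (pivot n).
  rewrite (leq_trans (mxrank_adds_leqif _ _)) // leq_add //.
  by rewrite genmxE rank_leq_row.
rewrite addn0 (leq_trans _ IHn) // mxrankS // addsmx_sub submx_refl genmxE.
by move: vn; rewrite negbK.
Qed.

(** The pivots are the greedy basis. A pivot lies outside the span of all its predecessors, hence
    outside that of its predecessors in [J], so each pivot in [J] raises the rank. *)
Lemma rank_prefix_span_ge (J : pred nat) n :
  (\sum_(i < n) (pivot i && J i) <= \rank (prefix_span J n))%N.
Proof.
elim: n => [|n IHn]; first by rewrite big_ord0.
rewrite prefix_span_recr big_ord_recr /=; case: ifP => Jn; last first.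
  by rewrite andbF addn0.
have le : (prefix_span J n <= prefix_span J n + <<v n>>)%MS by exact: addsmxSl.
have [vn|vn] := boolP (pivot n); last first.
  by rewrite addn0 (leq_trans IHn) // mxrankS.
rewrite addn1 (leq_ltn_trans IHn) //.
rewrite ltn_neqAle mxrankS // andbT; apply: contra vn => /eqP rk.
have : (prefix_span J n + <<v n>> <= prefix_span J n)%MS.
  by rewrite -mxrank_leqif_sup // rk.
rewrite addsmx_sub genmxE => /andP[_ vJ]; apply: submx_trans vJ _.
by apply/sumsmx_subP => i _; apply: (sumsmx_sup i).
Qed.

End Rank.

(* P is a multiple of the cyclotomic polynomial, which divides
   X^(p^l) - 1 = (X - 1)^(p^l) modulo p. *)
Lemma root_prim_mod p l (z : algC) (P : {poly int}) : prime p ->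
  (p ^ l)%N.-primitive_root z -> (map_poly intr P).[z] = 0 ->
  (P.[1])%:~R = 0 :> 'F_p.
Proof.
move=> p_pr pz Pz; set N := (p ^ l)%N in pz.
pose R := Pdiv.Ring.rmodp P 'Phi_N.
have PE := Pdiv.RingMonic.rdivp_eq (Cyclotomic_monic N) P.
have Phiz : (map_poly intr 'Phi_N).[z] = 0 :> algC.
  by rewrite (Cintr_Cyclotomic pz); apply/eqP; rewrite -/(root _ z) root_cyclotomic.
have Rz : (map_poly intr R).[z] = 0 :> algC.
  by move: Pz; rewrite PE rmorphD rmorphM /= !hornerE Phiz mulr0 add0r.
(* The minimal polynomial of z over the rationals is cyclotomic, and the remainder has smaller
   degree. *)
have R0 : R = 0.
  have [Q [QE Qmon Qdvd]] := minCpolyP z.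
  pose R' : {poly rat} := map_poly intr R.
  have R'E : map_poly ratr R' = map_poly intr R :> {poly algC}.
    rewrite /R' -map_poly_comp; apply: eq_map_poly => x /=; exact: ratr_int.
  have : root (map_poly ratr R') z by rewrite R'E /root Rz.
  rewrite Qdvd => QR; apply/eqP; apply: contraT => nzR.
  have nzR' : R' != 0.
    rewrite /R' map_poly_eq0_id0 // intr_eq0 lead_coef_eq0 //.
  have := dvdp_leq nzR' QR.
  have <- : size (minCpoly z) = size Q by rewrite QE size_map_poly.
  rewrite (minCpoly_cyclotomic pz) -(Cintr_Cyclotomic pz).
  rewrite size_map_inj_poly //; last exact: intr_inj.
  rewrite size_map_inj_poly //; last exact: intr_inj.
  have := Pdiv.Ring.ltn_rmodpN0 P (monic_neq0 (Cyclotomic_monic N)).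
  by rewrite -/R ltnNge => /negPf ->.
pose f : {poly int} -> {poly 'F_p} := map_poly intr.
have fphi : (f 'Phi_N).[1] = 0.
  (* Otherwise Phi_N modulo p is coprime to (X - 1)^N, which it divides, hence constant; but it is
     monic of positive degree. *)
  apply/eqP; apply: contraT => nz.
  have N0 : (0 < N)%N by rewrite expn_gt0 prime_gt0.
  have dv : f 'Phi_N %| ('X - 1) ^+ N.
    have -> : ('X - 1) ^+ N = 'X^N - 1 :> {poly 'F_p}.
      have qnat : [pchar {poly 'F_p}].-nat N.
        rewrite (eq_pnat _ (@pcharf_eq _ p _)) ?pchar_poly ?pchar_Fp //.
        by rewrite pnatX pnat_id.
      by rewrite exprDn_pchar // exprNn_pchar // expr1n.
    have := prod_Cyclotomic N0.
    rewrite (bigD1_seq N) ?divisors_uniq -?dvdn_divisors //= => /(congr1 f).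
    by rewrite /f rmorphM rmorphB /= map_polyXn rmorph1 => <-; rewrite dvdp_mulr.
  have cop : coprimep (f 'Phi_N) (('X - 1) ^+ N) by rewrite coprimep_sym X1_coprime.
  have cc := coprimep_dvdl dv cop.
  have : size (f 'Phi_N) = 1%N by apply/eqP; rewrite -coprimepp.
  rewrite size_map_poly_id0 ?(monicP (Cyclotomic_monic N)) ?rmorph1 ?oner_neq0 //.
  by rewrite size_Cyclotomic => -[/eqP]; rewrite eqn0Ngt totient_gt0 N0.
have := horner_map (intr : int -> 'F_p) P 1; rewrite rmorph1 /= => <-.
by rewrite PE -/R R0 addr0 rmorphM /= hornerM -/(f _) -/(f _) fphi mulr0.
Qed.

(** * Counting points on lines modulo p^l *)

(* The complete homogeneous symmetric polynomial of degree n - j in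
   a_0, ..., a_j, that is, the divided difference of x^n at these points. *)
Fixpoint hsym (R : pzRingType) (a : nat -> R) (j n : nat) {struct n} : R :=
  if n is n'.+1 then
    a j * hsym a j n' + (if j is j'.+1 then hsym a j' n' else 0)
  else (j == 0%N)%:R.

Lemma hsym_morph (R S : pzRingType) (f : {rmorphism R -> S}) a j n :
  f (hsym a j n) = hsym (f \o a) j n.
Proof.
elim: n j => [|n IHn] j /=; first by rewrite rmorph_nat.
by rewrite rmorphD rmorphM IHn; case: j => [|j]; rewrite ?rmorph0 ?IHn.
Qed.

Lemma eq_hsym (R : pzRingType) (a b : nat -> R) j n :
  a =1 b -> hsym a j n = hsym b j n.
Proof.
move=> ab; elim: n j => [|n IHn] j //=.
by rewrite ab IHn; case: j => [|j]; rewrite ?IHn.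
Qed.

(** When all nodes are 1 the recursion is Pascal's rule. *)
Lemma hsym1 (R : pzRingType) (a : nat -> R) j n :
  (forall i, a i = 1) -> hsym a j n = 'C(n, j)%:R.
Proof.
move=> a1; elim: n j => [|n IHn] j /=; first by rewrite bin0n.
rewrite a1 mul1r IHn; case: j => [|j]; first by rewrite !bin0 addr0.
by rewrite IHn binS natrD.
Qed.

(** Newton's interpolation formula at the node a_i, where the terms of order beyond i contain a zero
    factor. *)
Lemma newton_hsym (R : comPzRingType) (a : nat -> R) i n :
  a i ^+ n = \sum_(j < i.+1) hsym a j n * \prod_(k < j) (a i - a k).
Proof.
elim: n => [|n IHn].
  rewrite big_ord_recl [X in _ + X]big1 /= ?addr0; last by move=> j _; rewrite mul0r.
  by rewrite big_ord0 mulr1.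
rewrite exprS IHn mulr_sumr.
transitivity (\sum_(j < i.+1) (hsym a j n * \prod_(k < j.+1) (a i - a k) +
   a j * hsym a j n * \prod_(k < j) (a i - a k))).
  by apply: eq_bigr => j _; rewrite big_ord_recr /=; ring.
rewrite big_split /= [X in X + _]big_ord_recr /=.
rewrite [\prod_(k < i.+1) _]big_ord_recr /= subrr !mulr0 addr0.
rewrite [in RHS]big_ord_recl /= addr0 [X in _ + X = _]big_ord_recl addrCA.
congr (_ + _); rewrite -big_split /=; apply: eq_bigr => j _.
by rewrite /bump /= add1n mulrDl addrC.
Qed.

Lemma card_ord_mul_lt n q r : (0 < q)%N -> (r <= n)%N ->
  (r <= #|[set y : 'I_n | y * q < r]| * q)%N.
Proof.
case: r => [|r] q0 rn //.
set c := #|_|; suff cr : (r %/ q < c)%N.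
  by apply: leq_trans (ltn_ceil r q0) _; rewrite leq_mul2r cr orbT.
have le : ((r %/ q).+1 <= n)%N by apply: leq_trans rn; rewrite ltnS leq_div.
have inj1 : injective (widen_ord le) by move=> i j /(congr1 val) /= /val_inj.
rewrite -[X in (X <= _)%N]card_ord -(card_imset _ inj1).
apply: subset_leq_card; apply/fintype.subsetP => _ /imsetP[i _ ->]; rewrite inE /=.
by rewrite ltnS -leq_divRL // -ltnS ltn_ord.
Qed.

Section Kakeya.
Variables (p l k : nat).
Hypotheses (p_pr : prime p) (l_gt0 : (0 < l)%N).
Local Notation N := (p ^ l)%N.
Local Notation Z := 'Z_(p ^ l).
Local Notation V := 'rV['Z_(p ^ l)]_k.
Local Notation pt := (Z * V)%type.
Implicit Types (u w : V).

Let N_gt1 : (1 < N)%N := pl_gt1 p_pr l_gt0.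
Let cardZ : #|Z| = N. Proof. by rewrite card_ord Zp_cast. Qed.
Let cardV : #|{: V}| = (N ^ k)%N. Proof. by rewrite card_mx cardZ mul1n. Qed.

(** The index set to which [X1_independent] applies: y.1 is the exponent in a polynomial, and each
    unit of weight of y.2 costs l orders at 1. *)
Definition simplex r : {set pt} := [set y : pt | y.1 + l * wt y.2 < r]%N.

(** The simplex contains the box y_0 < r / (k+1), y_i < r / ((k+1) l), whose sides [card_ord_mul_lt]
    counts. *)
Lemma card_simplex r : (r <= N)%N ->
  (r ^ k.+1 <= #|simplex r| * (k.+1 ^ k.+1 * l ^ k))%N.
Proof.
move=> rN.
have rN' : (r <= (Zp_trunc N).+2)%N by rewrite Zp_cast.
pose Q q := [set a : Z | a * q < r]%N.
have bnd q : (0 < q)%N -> (r <= #|Q q| * q)%N by move=> q0; exact: card_ord_mul_lt.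
pose B := [set \row_i f i | f : {ffun 'I_k -> Z} in ffun_on (Q (k.+1 * l)%N)] : {set V}.
have cB : #|B| = (#|Q (k.+1 * l)%N| ^ k)%N.
  rewrite card_imset ?card_ffun_on ?card_ord // => f g /rowP fg.
  by apply/ffunP => i; have := fg i; rewrite !mxE.
have sub : finset.setX (Q k.+1) B \subset simplex r.
  apply/fintype.subsetP => -[a y]; rewrite !inE /=.
  move=> /andP[ar /imsetP[f /ffun_onP fQ ->]].
  rewrite -(ltn_pmul2l (ltn0Sn k)) mulnDr.
  have r0 : (0 < r)%N by apply: leq_ltn_trans ar.
  suff : (k.+1 * (l * wt (\row_i f i)) <= k * r)%N.
    by move=> h; rewrite [ltnRHS]mulSn -addSn leq_add // mulnC.
  rewrite mulnA /wt big_distrr /= -[X in (_ <= X * _)%N]card_ord -sum_nat_const.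
  apply: leq_sum => i _; rewrite mxE mulnC ltnW //.
  by have := fQ i; rewrite inE.
apply: leq_trans (leq_mul (subset_leq_card sub) (leqnn _)).
rewrite cardsX cB expnS.
have -> : (#|Q k.+1| * #|Q (k.+1 * l)%N| ^ k * (k.+1 ^ k.+1 * l ^ k) =
  (#|Q k.+1| * k.+1) * (#|Q (k.+1 * l)%N| * (k.+1 * l)) ^ k)%N.
  by rewrite !expnMn expnS; ring.
rewrite leq_mul ?bnd //; case: (k) => // k'.
by rewrite leq_exp2r // bnd // muln_gt0.
Qed.

Definition expo (u : V) (y : pt) : nat := (y.1 + dotn u y.2)%N.

Definition binrow (u : V) j : 'rV['F_p]_#|{: pt}| :=
  \row_y ('C(expo u (enum_val y), j))%:R.

(* The pairs (u, j) are enumerated with j as the major index, so that the first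
   r * #|V| rows are those with j < r. *)
Definition dir i : V := nth 0 (enum {: V}) (i %% #|{: V}|).
Definition binrows i := binrow (dir i) (i %/ #|{: V}|).

Let cardV_gt0 : (0 < #|{: V}|)%N. Proof. by rewrite cardV expn_gt0 ltnW. Qed.

Lemma dir_surj u j : exists2 i, (i %/ #|{: V}| = j)%N & dir i = u.
Proof.
have lt : (enum_rank u < #|{: V}|)%N by exact: ltn_ord.
exists (j * #|{: V}| + enum_rank u)%N; first by rewrite divnMDl // divn_small // addn0.
by rewrite /dir modnMDl modn_small // nth_enum_rank.
Qed.

Lemma dvdp_Xn_trunc (F : fieldType) r n :
  ('X - 1 : {poly F}) ^+ r %| 'X^n - \sum_(j < r) 'C(n, j)%:R *: ('X - 1) ^+ j.
Proof.
have XE : 'X^n = \sum_(j < n.+1) 'C(n, j)%:R *: ('X - 1) ^+ j :> {poly F}.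
  rewrite -{1}['X](subrK 1) addrC exprDn; apply: eq_bigr => j _.
  by rewrite expr1n mul1r scaler_nat.
have -> : 'X^n = \sum_(j < r + n.+1) 'C(n, j)%:R *: ('X - 1) ^+ j :> {poly F}.
  rewrite addnC XE big_split_ord -[LHS]addr0; congr (_ + _).
  by rewrite big1 // => j _; rewrite bin_small ?scale0r // ltn_addr.
rewrite big_split_ord /= addrAC subrr add0r.
elim/big_ind: _ => [|x y|j _]; first exact: dvdp0.
  exact: dvdp_add.
by rewrite exprD scalerAr dvdp_mulr.
Qed.

(* Since X^n = sum_j C(n, j) (X - 1)^j, a relation between columns says that a
   combination of the X^<(1,u),y> is divisible by (X - 1)^r for all u. *)
Lemma rank_binrows r : (r <= N)%N ->
  (#|simplex r| <= \rank (prefix_span binrows xpredT (r * #|{: V}|)))%N.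
Proof.
move=> rN; pose W := \matrix_(i < r * #|{: V}|) binrows i.
apply: (@leq_trans (\rank W)); last first.
  apply/mxrankS/row_subP => i; rewrite rowK.
  by rewrite (sumsmx_sup i) // genmxE.
rewrite -(card_imset _ enum_rank_inj); apply: rank_ge_free_cols => c c0 Wc.
pose cc (y : pt) : 'F_p := c (enum_rank y) 0.
have cc0 y : y \notin simplex r -> cc y = 0.
  by move=> yr; apply: c0; apply: contra yr => /imsetP[y' y'r /enum_rank_inj->].
pose g (y' : V) : {poly 'F_p} := \sum_(a : Z) cc (a, y') *: 'X^a.
suff g0 y' : g y' = 0.
  apply/colP => i; rewrite mxE; case E : (enum_val i) => [a y'].
  have /(congr1 (fun q : {poly _} => q`_a)) := g0 y'.
  rewrite coef0 coef_sum (bigD1 a) //= big1 ?addr0 => [|b ba].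
    by rewrite coefZ coefXn eqxx mulr1 /cc -E enum_valK.
  by rewrite coefZ coefXn eq_sym (inj_eq val_inj) (negPf ba) mulr0.
apply: (@X1_independent 'F_p p l (pchar_Fp p_pr) l_gt0 k r g _ _ y') => [{}y'|{y'} u].
  apply: leq_trans (size_sum _ _ _) _; apply/bigmax_leqP => a _.
  have [|/cc0->] := boolP ((a, y') \in simplex r); last by rewrite scale0r size_poly0.
  rewrite inE /= => ar; rewrite (leq_trans (size_scale_leq _ _)) // size_polyXn.
  by rewrite ltn_subRL addnC.
have -> : \sum_y' g y' * 'X^(dotn u y') = \sum_y cc y *: 'X^(expo u y).
  under eq_bigr do rewrite mulr_suml.
  rewrite exchange_big /= pair_bigA /=; apply: eq_bigr => -[a y'] _.
  by rewrite -scalerAl -exprD.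
(* The subtracted part is zero: it combines the relations [Wc] for the rows (u, j), j < r. *)
have -> : \sum_y cc y *: 'X^(expo u y) = \sum_y cc y *:
    ('X^(expo u y) - \sum_(j < r) 'C(expo u y, j)%:R *: ('X - 1) ^+ j).
  under [RHS]eq_bigr do rewrite scalerBr.
  rewrite sumrB; suff -> : \sum_y cc y *: \sum_(j < r) 'C(expo u y, j)%:R *: ('X - 1) ^+ j
      = 0 :> {poly 'F_p} by rewrite subr0.
  under eq_bigr do rewrite scaler_sumr.
  rewrite exchange_big /= big1 // => j _.
  under eq_bigr do rewrite scalerA.
  rewrite -scaler_suml; have [i ij iu] := dir_surj u j.
  have ir : (i < r * #|{: V}|)%N by rewrite -ltn_divLR // ij.
  have /colP/(_ (Ordinal ir)) := Wc; rewrite !mxE => Wi.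
  rewrite (reindex_onto (enum_val : 'I_#|{: pt}| -> pt) enum_rank) /=;
    last by move=> *; exact: enum_rankK.
  rewrite (eq_bigl xpredT) => [|y]; last by rewrite enum_valK eqxx.
  suff -> : \sum_(y < #|{: pt}|)
      cc (enum_val y) * 'C(expo u (enum_val y), j)%:R = 0 by rewrite scale0r.
  rewrite -[RHS]Wi; apply: eq_bigr => y _.
  by rewrite /cc enum_valK !mxE mulrC iu ij.
elim/big_ind: _ => [|x y|y _]; first exact: dvdp0.
  exact: dvdp_add.
by rewrite -mul_polyC dvdp_mull // dvdp_Xn_trunc.
Qed.

Section Lines.
Variables (S : {set pt}) (w : V -> V).

Definition line_pts (u : V) : {set Z} := [set t | (t, w u + t *: u) \in S].

Definition dotz (z y : V) : Z := \sum_i z 0 i * y 0 i.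

Lemma dotz_nat u y : dotz u y = (dotn u y)%:R.
Proof.
rewrite natr_sum; apply: eq_bigr => i _.
by rewrite natrM !natr_Zp.
Qed.

Variable z : algC.
Hypothesis z_prim : N.-primitive_root z.

Let e (x : Z) : algC := z ^+ x.

Let e_nat n : e n%:R = z ^+ n.
Proof. by rewrite /e val_Zp_nat // prim_expr_mod. Qed.

Let eD x y : e (x + y) = e x * e y.
Proof. by rewrite -{1}[x]natr_Zp -{1}[y]natr_Zp -natrD e_nat exprD. Qed.

Let e_mul (t : Z) n : e (t * n%:R) = e t ^+ n.
Proof. by rewrite -{1}[t]natr_Zp -natrM e_nat exprM. Qed.

Let e_inj : injective e.
Proof.
move=> x y /eqP; rewrite /e (eq_prim_root_expr z_prim) => /eqP.
by rewrite !modn_small ?Z_lt // => /val_inj.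
Qed.

(** For x = (t, z), this pairs the sheared point (t, z + t c) with y. *)
Definition shear_dot (c : V) (x y : pt) : Z := x.1 * y.1 + dotz (x.2 + x.1 *: c) y.2.

Definition charmx (c : V) : 'M[algC]_(#|S|, #|{: pt}|) :=
  \matrix_(s, y) e (shear_dot c (enum_val s) (enum_val y)).

(** The shear moves the line to direction u + c, where the character of the point with parameter t
    is e(<w u, y>) e(t)^n, n = <(1, u + c), y>. Newton's formula expands it in the rows of order at
    most j, the last with coefficient prod (a_j - a_i). This is nonzero because [e] is injective, so
    induction on j solves for that row. *)
Lemma hsym_row_sub (c u : V) j : (j < #|line_pts u|)%N ->
  (\row_(y < #|{: pt}|) (e (dotz (w u) (enum_val y).2) *
     hsym (fun i => e (nth 0 (enum (line_pts u)) i)) j (expo (u + c) (enum_val y)))%R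
   <= charmx c)%MS.
Proof.
elim/ltn_ind: j => j IHj ju; set a := fun i => e _.
set L := fun j => \row_(y < #|{: pt}|) (e (dotz (w u) (enum_val y).2) *
  hsym a j (expo (u + c) (enum_val y))).
rewrite -/(L j).
pose t := nth 0 (enum (line_pts u)) j.
have tS : (t, w u + t *: u) \in S.
  have := mem_nth 0 (s := enum (line_pts u)) (n := j).
  by rewrite -cardE mem_enum inE; apply.
have nz : \prod_(k < j) (a j - a k) != 0.
  apply/prodf_neq0 => i _; rewrite subr_eq0 (inj_eq e_inj) nth_uniq ?enum_uniq -?cardE //.
    by rewrite gtn_eqF.
  exact: ltn_trans ju.
have LE : (\prod_(k < j) (a j - a k)) *: L j =
    row (enum_rank_in tS (t, w u + t *: u)) (charmx c) -
    \sum_(i < j) \prod_(k < i) (a j - a k) *: L i.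
  apply/eqP; rewrite -subr_eq opprK eq_sym; apply/eqP/rowP => y.
  rewrite !mxE summxE enum_rankK_in //.
  under [\sum_(i < j) _]eq_bigr do rewrite !mxE mulrC -mulrA.
  rewrite -mulr_sumr; case: (enum_val y) => b y' /=.
  have := newton_hsym a j (expo (u + c) (b, y')).
  rewrite big_ord_recr /= => /(congr1 (fun q => e (dotz (w u) y') * q)).
  rewrite mulrDr [X in _ = _ + X]mulrA [X in _ = _ + X]mulrC => E.
  rewrite addrC.
  rewrite -E /a -/t -e_mul -eD /shear_dot; congr e => /=.
  rewrite /expo natrD natr_Zp -dotz_nat mulrDr addrCA; congr (_ + _).
  rewrite /dotz mulr_sumr -big_split /=; apply: eq_bigr => i _.
  by rewrite !mxE; ring.
rewrite -[L j]scale1r -(mulVf nz) -scalerA LE scalemx_sub // addmx_sub ?row_sub //.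
rewrite eqmx_opp summx_sub // => i _; rewrite scalemx_sub //.
by apply: IHj => //; apply: ltn_trans ju.
Qed.

(** The shear by c sends direction u to u + c, so row (v, j) belongs to the line of S in direction v
    - c. *)
Definition in_line (c : V) i := (i %/ #|{: V}| < #|line_pts (dir i - c)%R|)%N.

(* At X = zeta the rows of E are combinations of the characters of the sheared
   points of S; at X = 1 they reduce to [binrows] modulo p. *)
Lemma rank_sheared_lines (c : V) n :
  (\rank (prefix_span binrows (in_line c) n) <= #|S|)%N.
Proof.
pose a (u : V) m := nth 0 (enum (line_pts u)) m : Z.
pose E : 'M[{poly int}]_(n, #|{: pt}|) := \matrix_(i, y)
  if in_line c i then
    'X^(dotz (w (dir i - c)) (enum_val y).2) *
      hsym (fun m => 'X^(a (dir i - c) m)) (i %/ #|{: V}|) (expo (dir i) (enum_val y))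
  else 0.
pose f : {rmorphism {poly int} -> 'F_p} := intr \o horner_eval 1.
pose g : {rmorphism {poly int} -> algC} := horner_eval z \o map_poly intr.
have fg q : g q = 0 -> f q = 0 by move=> /(root_prim_mod p_pr z_prim).
have fX m : f 'X^m = 1 by rewrite /f /= horner_evalE hornerXn expr1n.
have gX m : g 'X^m = z ^+ m by rewrite /g /= map_polyXn horner_evalE hornerXn.
apply: (@leq_trans (\rank (map_mx f E))).
  apply/mxrankS/sumsmx_subP => i Ji; rewrite genmxE.
  suff -> : binrows i = row i (map_mx f E) by exact: row_sub.
  apply/rowP => y; rewrite !mxE Ji rmorphM hsym_morph fX mul1r hsym1 // => m.
  exact: fX.
apply: leq_trans (rank_specialize _ fg) _.
apply: leq_trans (rank_leq_row (charmx c)); apply/mxrankS/row_subP => i.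
have [Ji|nJi] := boolP (in_line c i); last first.
  suff -> : row i (map_mx g E) = 0 by exact: sub0mx.
  by apply/rowP => y; rewrite !mxE (negPf nJi) rmorph0.
have := hsym_row_sub c Ji; congr (_ <= _)%MS.
apply/rowP => y; rewrite !mxE Ji rmorphM hsym_morph gX subrK; congr (_ * _).
by apply: eq_hsym => m; exact/esym/gX.
Qed.

End Lines.

Lemma kakeya_count (S : {set pt}) (w : V -> V) :
  (\sum_(u : V) #|line_pts S w u| ^ k.+1 <=
   N ^ k * #|S| * (k.+1 ^ k.+1 * l ^ k))%N.
Proof.
have [z z_prim] := C_prim_root_exists (ltnW N_gt1 : 0 < N)%N.
pose r u := #|line_pts S w u|.
have rN u : (r u <= N)%N by rewrite -cardZ max_card.
apply: (@leq_trans ((\sum_u #|simplex (r u)|) * (k.+1 ^ k.+1 * l ^ k))).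
  by rewrite big_distrl leq_sum // => u _; apply: card_simplex; exact: rN.
rewrite leq_mul2r; apply/orP; right.
pose n := (N * #|{: V}|)%N; pose piv i : nat := pivot binrows i.
apply: (@leq_trans (\sum_u \sum_(i < n) piv i * (i %/ #|{: V}| < r u))).
  apply: leq_sum => u _; apply: leq_trans (rank_binrows (rN u)) _.
  apply: leq_trans (rank_prefix_span_le _ _) _.
  have le : (r u * #|{: V}| <= n)%N by rewrite leq_mul2r rN orbT.
  rewrite (big_ord_widen _ (fun i => pivot binrows i : nat) le) big_mkcond /=.
  apply: leq_sum => i _; rewrite /piv ltn_divLR //.
  by case: ifP; rewrite ?muln1.
(* For fixed i, the substitution u = [dir i] - c turns the sum over directions into a sum over
   shears. *)
apply: (@leq_trans (\sum_c \sum_(i < n) (pivot binrows i && in_line S w c i))).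
  rewrite exchange_big [leqRHS]exchange_big; apply: leq_sum => i _ /=.
  rewrite (reindex_inj (inj_comp (addrI (dir i)) oppr_inj)) /=.
  by apply: leq_sum => c _; rewrite /in_line /r mulnb.
rewrite -cardV -sum_nat_const; apply: leq_sum => c _.
apply: leq_trans (rank_prefix_span_ge _ _ _) _.
exact: rank_sheared_lines z_prim _ _.
Qed.

End Kakeya.

(** * From the counting bound to the maximal inequality modulo p^l *)

Lemma sum_exp_le (R : realDomainType) n m (b : 'I_n.+1 -> R) :
  (forall i, 0 <= b i) ->
  (\sum_i b i) ^+ m.+1 <= n.+1%:R ^+ m.+1 * \sum_i b i ^+ m.+1.
Proof.
(* Every term is bounded by the largest one, a crude form of the power mean inequality. *)
move=> b0; have [i0 _ ib] := @Order.TotalTheory.arg_maxP _ _ _ ord0 xpredT b isT.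
apply: (@le_trans _ _ ((n.+1%:R * b i0) ^+ m.+1)).
  rewrite lerXn2r // ?nnegrE ?sumr_ge0 ?mulr_ge0 //.
  rewrite -[n.+1 in leRHS]card_ord mulr_natl -sumr_const.
  by apply: ler_sum => i _; exact: ib.
rewrite exprMn ler_wpM2l ?exprn_ge0 // (bigD1 i0) //= lerDl.
by rewrite sumr_ge0 // => i _; rewrite exprn_ge0.
Qed.

Section MaximalFunction.
Variables (p l k : nat).
Hypotheses (p_pr : prime p) (l_gt0 : (0 < l)%N).
Local Notation N := (p ^ l)%N.
Local Notation Z := 'Z_(p ^ l).
Local Notation V := 'rV['Z_(p ^ l)]_k.
Local Notation pt := (Z * V)%type.
Variables (R : realFieldType) (F : pt -> R).
Hypothesis F_ge0 : forall y, 0 <= F y.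

(** Induction on n: either F y exceeds M p^-(n+1) and the new term replaces the old remainder M
    p^-n, or F y is at most the new remainder. *)
Lemma level_decomposition (M : R) y n : F y <= M ->
  F y <= \sum_(j < n) M * p%:R ^- j * (M * p%:R ^- j.+1 < F y)%R%:R + M * p%:R ^- n.
Proof.
move=> FM; have M0 : 0 <= M by exact: le_trans FM.
elim: n => [|n IHn]; first by rewrite big_ord0 add0r expr0 invr1 mulr1.
rewrite big_ord_recr /=; case: ltP => [lt|le].
  rewrite mulr1 (le_trans IHn) // lerDl mulr_ge0 // invr_ge0 exprn_ge0 //.
rewrite mulr0 addr0 (le_trans le) // lerDr sumr_ge0 // => j _.
by rewrite !mulr_ge0 // invr_ge0 exprn_ge0.
Qed.

(* The set is cut into the l levels M p^-(j+1) < F with M = max F; what lies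
   below M p^-l contributes at most M to a line. *)
Lemma kakeya_maximal_discrete (w : V -> V) :
  \sum_u (\sum_(t : Z) F (t, w u + t *: u)) ^+ k.+1 <=
  ((k.+1 * p)%:R ^+ k.+1 + 1) * (l%:R + 1) ^+ (2 * k.+1) *
    (N ^ k)%:R * \sum_y F y ^+ k.+1.
Proof.
have [y0 _ FM] := @Order.TotalTheory.arg_maxP _ _ _ (0 : pt) xpredT F isT.
set M := F y0 in FM; have M0 : 0 <= M by exact: F_ge0.
have p0 : 0 < p%:R :> R by rewrite ltr0n prime_gt0.
have p_ge0 : 0 <= p%:R :> R by exact: ltW.
set T := \sum_y F y ^+ k.+1.
have T0 : 0 <= T by apply: sumr_ge0 => y _; exact/exprn_ge0/F_ge0.
have MT : M ^+ k.+1 <= T.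
  by rewrite /T (bigD1 y0) //= lerDl sumr_ge0 // => y _; rewrite exprn_ge0 ?F_ge0.
pose S j : {set pt} := [set y | M * p%:R ^- j.+1 < F y].
(* Chebyshev's inequality: on [S j] the value M p^-j is less than p F. *)
have cheb j : (M * p%:R ^- j) ^+ k.+1 * #|S j|%:R <= p%:R ^+ k.+1 * T.
  have -> : M * p%:R ^- j = p%:R * (M * p%:R ^- j.+1).
    by rewrite exprS invfM [RHS]mulrCA mulVKf ?gt_eqF.
  rewrite exprMn -mulrA ler_wpM2l ?exprn_ge0 ?p_ge0 //.
  rewrite mulrC mulr_natl -sumr_const /T [leRHS](bigID (mem (S j))) /=.
  rewrite -[leLHS]addr0 lerD ?sumr_ge0 // => [|y _]; last by rewrite exprn_ge0 ?F_ge0.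
  apply: ler_sum => y; rewrite inE => My.
  by rewrite lerXn2r ?nnegrE ?F_ge0 ?mulr_ge0 ?invr_ge0 ?exprn_ge0 // ltW.
(* The index j = l carries the remainder: M p^-l summed over the p^l points of a line is M. *)
pose b u (j : nat) := if (j < l)%N then M * p%:R ^- j * #|line_pts (S j) w u|%:R else M.
have b0 u j : 0 <= b u j.
  by rewrite /b; case: ifP => // _; rewrite !mulr_ge0 ?invr_ge0 ?exprn_ge0.
have Fb u : \sum_(t : Z) F (t, w u + t *: u) <= \sum_(j < l.+1) b u j.
  apply: le_trans (ler_sum _ (fun t _ => level_decomposition l (FM _ isT))) _.
  rewrite big_split exchange_big [leRHS]big_ord_recr /= [b u l]/b ltnn lerD //.
    apply: ler_sum => j _; rewrite /b ltn_ord -mulr_sumr ler_wpM2l //.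
      by rewrite mulr_ge0 // invr_ge0 exprn_ge0.
    rewrite -natr_sum ler_nat -sum1_card [leqRHS]big_mkcond leq_sum // => t _.
    by rewrite !inE; case: (_ < _)%R.
  rewrite sumr_const card_ord Zp_cast ?pl_gt1 // -[_ *+ N]mulr_natr natrX.
  rewrite -mulrA mulVf ?mulr1 //.
  by rewrite expf_neq0 ?gt_eqF.
have step1 : \sum_u (\sum_(t : Z) F (t, w u + t *: u)) ^+ k.+1 <=
    l.+1%:R ^+ k.+1 * \sum_(j < l.+1) \sum_u b u j ^+ k.+1.
  rewrite exchange_big mulr_sumr; apply: ler_sum => u _.
  apply: le_trans (sum_exp_le k _) => //.
  by rewrite lerXn2r ?nnegrE ?sumr_ge0.
have stepj j : (j < l)%N -> \sum_u b u j ^+ k.+1 <=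
   (N ^ k)%:R * (k.+1 ^ k.+1 * l ^ k)%:R * (p%:R ^+ k.+1 * T).
  move=> jl; rewrite (eq_bigr (fun u => (M * p%:R ^- j) ^+ k.+1 *
    (#|line_pts (S j) w u| ^ k.+1)%:R)); last first.
    by move=> u _; rewrite /b jl exprMn natrX.
  rewrite -mulr_sumr -natr_sum.
  apply: (@le_trans _ _ ((M * p%:R ^- j) ^+ k.+1 *
      (N ^ k * #|S j| * (k.+1 ^ k.+1 * l ^ k))%:R)).
    rewrite ler_wpM2l ?exprn_ge0 ?mulr_ge0 ?invr_ge0 ?exprn_ge0 //.
    by rewrite ler_nat kakeya_count.
  rewrite mulnAC natrM [leLHS]mulrCA natrM ler_wpM2l ?mulr_ge0 // cheb.
apply: le_trans step1 _; rewrite big_ord_recr /=.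
have -> : \sum_u b u l ^+ k.+1 = (N ^ k)%:R * M ^+ k.+1.
  rewrite (eq_bigr (fun=> M ^+ k.+1)) => [|u _]; last by rewrite /b ltnn.
  rewrite sumr_const card_mx mul1n card_ord Zp_cast ?pl_gt1 //.
  by rewrite -[_ *+ (N ^ k)]mulr_natl.
(* The l levels contribute l times l^k; with the factor from [sum_exp_le] this makes the exponent 2
   (k+1) of l + 1. *)
apply: (@le_trans _ _ (l.+1%:R ^+ k.+1 * ((N ^ k)%:R * T *
    (((k.+1 * p)%:R ^+ k.+1 + 1) * l.+1%:R ^+ k.+1)))); last first.
  by rewrite mulnC exprM -natr1 expr2 exprMn le_eqVlt; apply/orP; left; apply/eqP; ring.
rewrite ler_wpM2l ?exprn_ge0 //.
apply: (@le_trans _ _ ((N ^ k)%:R * T * (((k.+1 * p)%:R ^+ k.+1) * l%:R ^+ k.+1 + 1))).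
  rewrite mulrDr mulr1 lerD ?ler_wpM2l //.
  apply: (@le_trans _ _ (\sum_(j < l)
      (N ^ k)%:R * (k.+1 ^ k.+1 * l ^ k)%:R * (p%:R ^+ k.+1 * T))).
    by apply: ler_sum => j _; exact: stepj.
  rewrite sumr_const card_ord -mulr_natl le_eqVlt; apply/orP; left; apply/eqP.
  by rewrite !natrM !natrX exprMn [l%:R ^+ k.+1]exprS; ring.
rewrite ler_wpM2l ?mulr_ge0 //.
rewrite [leRHS]mulrDl mul1r lerD ?ler_wpM2l ?exprn_ge0 ?exprn_ege1 ?ler1n //.
by rewrite lerXn2r ?nnegrE ?ler_nat.
Qed.

End MaximalFunction.

(** * Haar measure and residues *)

Local Open Scope classical_set_scope.

Section FiniteFibers.
Local Open Scope ereal_scope.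
Context d (T : measurableType d) (R : realType) (mu : {measure set T -> \bar R}).
Variables (Q : finType) (pr : T -> Q).
Local Notation fib c := (pr @^-1` [set c]).
Hypothesis mfib : forall c, measurable (fib c).

Lemma measurable_fun_fibers d' (T' : measurableType d') (g : Q -> T -> T') :
  (forall c, measurable_fun setT (g c)) -> measurable_fun setT (fun x => g (pr x) x).
Proof.
move=> mg _ Y mY; rewrite setTI.
have -> : (fun x => g (pr x) x) @^-1` Y = \bigcup_(c in [set: Q]) (fib c `&` g c @^-1` Y).
  apply/seteqP; split => [x Yx|x [c _ [<- //]]].
  by exists (pr x).
apply: fin_bigcup_measurable => [|c _]; first exact: finite_finset.
by apply: measurableI => //; rewrite -[X in measurable X]setTI; exact: mg.
Qed.

Lemma integral_fibers (f : T -> \bar R) : measurable_fun setT f ->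
  (forall x, 0 <= f x) -> \int[mu]_x f x = \sum_c \int[mu]_(x in fib c) f x.
Proof.
move=> mf f0.
have E : \big[setU/set0]_(c <- index_enum Q) fib c = setT.
  rewrite -subTset => x _; rewrite -bigcup_seq; exists (pr x) => //=.
  exact: mem_index_enum.
rewrite -[in LHS]E ge0_integral_bigsetU //.
- exact: index_enum_uniq.
- by move=> i j _ _ [x [/= <- <-]].
- by rewrite E.
Qed.

Lemma integral_fiber_cst (g : Q -> \bar R) : (forall c, 0 <= g c) ->
  \int[mu]_x g (pr x) = \sum_c g c * mu (fib c).
Proof.
move=> g0; rewrite integral_fibers //.
  apply: eq_bigr => c _; rewrite -integral_cst //; apply: eq_integral => x.
  by rewrite inE => <-.
by apply: (measurable_fun_fibers (g := fun c => cst (g c))) => c; exact: measurable_cst.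
Qed.

Lemma equal_fibers : (forall c c', mu (fib c) = mu (fib c')) ->
  mu setT = 1 -> forall c, mu (fib c) = (#|Q|%:R^-1)%:E.
Proof.
move=> eqf mu1 c.
have := @integral_fiber_cst (cst 1) (fun=> lee01).
rewrite integral_cst // mul1e mu1 => /esym.
under eq_bigr do rewrite mul1e (eqf _ c).
have : mu (fib c) \is a fin_num.
  by apply: lty_fin_num_fun => //; rewrite mu1 ltry.
case: (mu (fib c)) => // r _; rewrite sumEFin sumr_const => -[rE]; congr EFin.
have Q0 : (#|Q|%:R != 0 :> R)%R.
  by apply: contra_eqN rE => /eqP Q0; rewrite -mulr_natl Q0 mul0r eq_sym oner_eq0.
by rewrite -[LHS](mulKf Q0) mulr_natl rE mulr1.
Qed.

End FiniteFibers.

(** Translations permute the fibres transitively, so these share the total mass 1 equally. *)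
Lemma haar_fibers d (G : measurableType d) (R : realType) (mu : probability G R)
    (add : G -> G -> G) (Q : finType) (pr : G -> Q) :
  normalized_haar mu add ->
  (forall c, measurable (pr @^-1` [set c])) ->
  (forall c c', exists g, [set add g x | x in pr @^-1` [set c]] = pr @^-1` [set c']) ->
  forall c, mu (pr @^-1` [set c]) = (#|Q|%:R^-1)%:E.
Proof.
move=> haar mpr trans; apply: equal_fibers => //; last exact: probability_setT.
by move=> c c'; have [g <-] := trans c c'; exact/esym/haar/mpr.
Qed.

(** * Congruence cells and the Borel sets of the product *)

Section Congruence.
Variables (p k : nat).
Local Notation Zp := (padic_int p).
Local Notation Vp := 'rV[padic_int p]_k.

Definition congr_row n (x y : Vp) := forall i, x 0 i n = y 0 i n.

Definition cell n (y : Zp * Vp) : set (Zp * Vp) :=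
  [set x : Zp * Vp | x.1 n = y.1 n /\ congr_row n x.2 y.2].

Lemma padic_openP (U : set Zp) :
  open U <-> forall x, U x -> exists n, [set y : Zp | y n = x n] `<=` U.
Proof. by []. Qed.

Lemma open_residue (x : Zp) n : open [set y : Zp | y n = x n].
Proof. by apply/padic_openP => y yx; exists n => z /= ->. Qed.

Lemma open_congr_row (x : Vp) n : open [set y : Vp | congr_row n y x].
Proof.
rewrite openE => y yx.
exists (fun i j => [set z : Zp | z n = y i j n]) => [i j|z zy j /=].
  by apply: open_nbhs_nbhs; split => //; exact: open_residue.
by rewrite zy yx.
Qed.

Lemma congr_row_nbhs (U : set Vp) (x : Vp) : open U -> U x ->
  exists n, forall y, congr_row n y x -> U y.
Proof.
rewrite openE => /[apply] -[P nP PU].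
have /choice[f fP] : forall j, exists n, [set y : Zp | y n = x 0 j n] `<=` P 0 j.
  move=> j; have := nP 0 j; rewrite nbhsE => -[V [oV Vx] VP].
  have [n nV] := (padic_openP V).1 oV _ Vx.
  by exists n; exact: subset_trans nV VP.
exists (\max_j f j)%N => y yx; apply: PU => i j; rewrite ord1; apply: fP.
by apply: residue_le (yx j); exact: leq_bigmax.
Qed.

(** Natural numbers as constant sequences: countably many centres that meet every residue class. *)
Definition padic_nat (a : nat) : Zp := @padic_of p (fun=> a%:Z) (fun=> erefl).

Lemma padic_nat_residue (x : Zp) n : (0 < p)%N -> exists a, x n = padic_nat a n.
Proof.
move=> p0; exists `|x n|%N; rewrite /= gez0_abs ?residue_small //.
by rewrite -residue_small modz_ge0 // expf_neq0 // eqz_nat -lt0n.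
Qed.

Lemma cell_subset n m x y z :
  (n <= m)%N -> cell n x z -> cell m y z -> cell m y `<=` cell n x.
Proof.
move=> nm [x1 x2] [y1 y2] t [t1 t2]; split.
  by rewrite -x1; apply: residue_le nm _; rewrite t1 y1.
by move=> i; rewrite -x2; apply: residue_le nm _; rewrite t2 y2.
Qed.

Definition cells : set (set (Zp * Vp)) :=
  [set A | A = set0 \/ exists n y, A = cell n y].

Lemma cells_setI : setI_closed cells.
Proof.
move=> A B [->|[n [x ->]]]; first by rewrite set0I; left.
move=> [->|[m [y ->]]]; first by rewrite setI0; left.
have [->|/set0P[z [xz yz]]] := eqVneq (cell n x `&` cell m y) set0; first by left.
right; have [nm|/ltnW mn] := leqP n m.
  by exists m, y; apply/setIidr; exact: cell_subset xz yz.
by exists n, x; apply/setIidl; exact: cell_subset yz xz.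
Qed.

(** The rectangle is the union of the cells inside it whose centres have natural coordinates, a
    countable family. *)
Lemma open_rect_cells (U : set Zp) (W : set Vp) : (0 < p)%N ->
  open U -> open W -> <<s cells >> (U `*` W).
Proof.
move=> p0 oU oW.
pose c (q : nat * nat * 'rV[nat]_k) :=
  cell q.1.1 (padic_nat q.1.2, \row_i padic_nat (q.2 0 i)).
have -> : U `*` W = \bigcup_q (if `[< c q `<=` U `*` W >] then c q else set0).
  apply/seteqP; split => [[x z] [/= Ux Wz]|x [q _]]; last by case: asboolP => // /[apply].
  have [n1 n1U] := (padic_openP U).1 oU _ Ux.
  have [n2 n2W] := congr_row_nbhs oW Wz.
  pose n := maxn n1 n2.
  have [a aE] := padic_nat_residue x n p0.
  have /choice[b bE] : forall i, exists b, z 0 i n = padic_nat b n.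
    by move=> i; exact: padic_nat_residue.
  exists (n, a, \row_i b i) => //.
  case: asboolP => [_|]; first by split => // i; rewrite !mxE.
  case=> -[x' z'] [/= x1 z1]; split => /=.
    by apply: n1U => /=; apply: residue_le (leq_maxl n1 n2) _; rewrite x1 aE.
  apply: n2W => i; apply: residue_le (leq_maxr n1 n2) _.
  by rewrite (z1 i) !mxE -bE.
apply: (@countable_bigcupT_measurable _ (g_sigma_algebraType cells)) => // q.
by case: ifP => _; apply: sub_sigma_algebra; [right; do 2 eexists|left].
Qed.

Lemma measurable_cells : (0 < p)%N -> @measurable _ (Zp * Vp)%type = <<s cells >>.
Proof.
move=> p0; apply/seteqP; split.
  apply: smallest_sub; first exact: smallest_sigma_algebra.
  have m1 : measurable_fun setT (fst : g_sigma_algebraType cells -> Zp).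
    apply: measurability => [|_ [U oU <-]]; first by [].
   
    by rewrite setTI -setXT; apply: open_rect_cells => //; exact: openT.
  have m2 : measurable_fun setT (snd : g_sigma_algebraType cells -> Vp).
    apply: measurability => [|_ [U oU <-]]; first by [].
   
    by rewrite setTI -setTX; apply: open_rect_cells => //; exact: openT.
  by move=> A [[U mU <-]|[U mU <-]]; [exact: m1|exact: m2].
apply: smallest_sub; first exact: sigma_algebra_measurable.
move=> _ [->|[n [y ->]]]; first exact: measurable0.
have -> : cell n y = [set x : Zp | x n = y.1 n] `*` [set z | congr_row n z y.2] by [].
apply: measurableX; apply: sub_sigma_algebra; first exact: open_residue.
exact: open_congr_row.
Qed.

End Congruence.

Lemma additive_fibers (G Q : zmodType) (pr : G -> Q) (s : Q -> G) :
  (forall x y, pr (x + y) = pr x + pr y) -> cancel s pr ->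
  forall c c', exists g, [set g + x | x in pr @^-1` [set c]] = pr @^-1` [set c'].
Proof.
move=> prD sK c c'; exists (s (c' - c)); apply/seteqP; split => [_ [x /= <- <-]|y /= yc'].
  by rewrite /= prD sK subrK.
exists (y - s (c' - c)); last by rewrite addrC subrK.
by apply: (addIr (pr (s (c' - c)))); rewrite -prD subrK sK yc' addrC subrK.
Qed.

(** * Reduction modulo p^l *)

Section Reduction.
Variables (p l k : nat).
Hypotheses (p_pr : prime p) (l_gt0 : (0 < l)%N).
Local Notation Zp := (padic_int p).
Local Notation Vp := 'rV[padic_int p]_k.
Local Notation Z := 'Z_(p ^ l).
Local Notation V := 'rV['Z_(p ^ l)]_k.

Let N_gt1 : (1 < p ^ l)%N := pl_gt1 p_pr l_gt0.

Definition red (x : Zp) : Z := (x l)%:~R.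
Definition redv (z : Vp) : V := map_mx red z.
Definition redp (x : Zp * Vp) : Z * V := (red x.1, redv x.2).

Lemma intr_mod_pl (a : int) : (a %% p%:Z ^+ l)%Z%:~R = a%:~R :> Z.
Proof.
rewrite [in RHS](divz_eq a (p%:Z ^+ l)) [RHS]intrD intrM (rmorphXn (intr : int -> Z)).
by rewrite -natrX pchar_Zp // mulr0 add0r.
Qed.

Lemma redD x y : red (x + y) = red x + red y.
Proof. by rewrite /red /= intr_mod_pl intrD. Qed.

Lemma redM x y : red (x * y) = red x * red y.
Proof. by rewrite /red /= intr_mod_pl intrM. Qed.

Lemma redvD x y : redv (x + y) = redv x + redv y.
Proof. by apply/rowP => i; rewrite !mxE redD. Qed.

Lemma redvZ t y : redv (t *: y) = red t *: redv y.
Proof. by apply/rowP => i; rewrite !mxE redM. Qed.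

Lemma redpD x y : redp (x + y) = redp x + redp y.
Proof. by rewrite /redp redD redvD. Qed.

Lemma red_eq x y : red x = red y <-> x l = y l.
Proof.
split => [|xy]; last by rewrite /red xy.
have repr (z : Zp) : exists2 n, z l = n%:Z & (n < p ^ l)%N.
  have pl0 : p%:Z ^+ l != 0 by rewrite expf_neq0 // eqz_nat -lt0n prime_gt0.
  exists `|z l|%N; first by rewrite gez0_abs // -residue_small modz_ge0.
  rewrite -ltz_nat gez0_abs; last by rewrite -residue_small modz_ge0.
  rewrite -natz natrX natz -residue_small ltz_pmod //.
  by rewrite exprn_gt0 // ltz_nat prime_gt0.
have [[a aE aN] [b bE bN]] := (repr x, repr y).
rewrite /red aE bE => /(congr1 val) /=.
by rewrite !val_Zp_nat // !modn_small // => ->.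
Qed.

Lemma redv_eq x y : redv x = redv y <-> congr_row l x y.
Proof.
split => [/rowP xy i|xy]; first by have := xy i; rewrite !mxE => /red_eq.
by apply/rowP => i; rewrite !mxE; apply/red_eq.
Qed.

Definition unred (a : Z) : Zp := padic_nat p a.
Definition unredv (z : V) : Vp := map_mx unred z.
Definition unredp (x : Z * V) : Zp * Vp := (unred x.1, unredv x.2).

Lemma unredK : cancel unred red.
Proof. by move=> a; rewrite /red /= intr_mod_pl -[RHS]natr_Zp. Qed.

Lemma unredvK : cancel unredv redv.
Proof. by move=> z; apply/rowP => i; rewrite !mxE unredK. Qed.

Lemma unredpK : cancel unredp redp.
Proof. by move=> [a z]; rewrite /redp unredK unredvK. Qed.

Lemma measurable_red c : measurable (red @^-1` [set c]).
Proof.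
apply: sub_sigma_algebra; rewrite -(unredK c).
suff -> : red @^-1` [set red (unred c)] = [set x : Zp | x l = unred c l].
  exact: open_residue.
by apply/seteqP; split => x xc; apply/red_eq.
Qed.

Lemma measurable_redv c : measurable (redv @^-1` [set c]).
Proof.
apply: sub_sigma_algebra; rewrite -(unredvK c).
suff -> : redv @^-1` [set redv (unredv c)] =
    [set x : Vp | congr_row l x (unredv c)].
  exact: open_congr_row.
by apply/seteqP; split => x xc; apply/redv_eq.
Qed.

Lemma redp_fiber c : redp @^-1` [set c] =
  (red @^-1` [set c.1]) `*` (redv @^-1` [set c.2]).
Proof.
case: c => a b; apply/seteqP; split => [x [<- <-] |x [/= xa xb]] //.
by rewrite /= /redp xa xb.
Qed.

Lemma measurable_redp c : measurable (redp @^-1` [set c]).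
Proof.
rewrite redp_fiber; apply: measurableX; first exact: measurable_red.
exact: measurable_redv.
Qed.

Lemma cell_fiber y : cell l y = redp @^-1` [set redp y].
Proof.
apply/seteqP; split => [x [x1 x2]|x [x1 x2]].
  by congr pair; [apply/red_eq|apply/redv_eq].
by split; [apply/red_eq|apply/redv_eq].
Qed.

Section HaarFibers.
Variable R : realType.

Lemma haar_red (mu : probability Zp R) c : normalized_haar mu +%R ->
  mu (red @^-1` [set c]) = ((p ^ l)%:R^-1)%:E.
Proof.
move=> h; rewrite (haar_fibers h measurable_red (additive_fibers redD unredK)).
by rewrite card_ord Zp_cast.
Qed.

Lemma haar_redv (mu : probability Vp R) c : normalized_haar mu +%R ->
  mu (redv @^-1` [set c]) = (((p ^ l) ^ k)%:R^-1)%:E.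
Proof.
move=> h; rewrite (haar_fibers h measurable_redv (additive_fibers redvD unredvK)).
by rewrite card_mx mul1n card_ord Zp_cast.
Qed.

Lemma haar_redp (nu : probability (Zp * Vp)%type R) c : normalized_haar nu +%R ->
  nu (redp @^-1` [set c]) = (((p ^ l) ^ k.+1)%:R^-1)%:E.
Proof.
move=> h; rewrite (haar_fibers h measurable_redp (additive_fibers redpD unredpK)).
by rewrite card_prod card_mx mul1n card_ord Zp_cast // expnS.
Qed.

End HaarFibers.

End Reduction.

Arguments redv {p} l {k} z.
Arguments redp {p} l {k} x.

Section ProductHaar.
Variables (R : realType) (p k : nat).
Hypothesis p_pr : prime p.
Local Notation Zp := (padic_int p).
Local Notation Vp := 'rV[padic_int p]_k.
Variables (mu1 : probability Zp R) (mu2 : probability Vp R).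
Variable nu : probability (Zp * Vp)%type R.
Hypotheses (haar1 : normalized_haar mu1 +%R) (haar2 : normalized_haar mu2 +%R).
Hypothesis haar : normalized_haar nu +%R.

(** Both measures give a cell of level n the mass p^-(n (k+1)), and the cells are a generating
    pi-system. This gives access to Tonelli's theorem for [nu]. *)
Lemma haar_product (D : set (Zp * Vp)) : measurable D -> nu D = (mu1 \x mu2)%E D.
Proof.
have cell0 y : @cell p k 0 y = setT.
  apply/seteqP; split => // x _; split.
    by rewrite -residue_small modz1 -[RHS]residue_small modz1.
  by move=> i; rewrite -residue_small modz1 -[RHS]residue_small modz1.
have prodE A B : measurable A -> measurable B ->
  (mu1 \x mu2)%E (A `*` B) = (mu1 A * mu2 B)%E by exact: product_measure1E.
apply: (@measure_unique _ _ _ (@cells p k) (fun=> setT)) => //.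
- by apply: measurable_cells; exact: prime_gt0.
- exact: cells_setI.
- by move=> _; right; exists 0%N, 0; rewrite cell0.
- by rewrite bigcup_const //; exists 0%N.
- move=> _ [->|[n [y ->]]]; first by rewrite !measure0.
  (* Level 0, the whole space, is treated apart because the reduction lemmas are stated for positive
     level. *)
  case: n => [|n].
    rewrite cell0; transitivity (1%E : \bar R); first exact: probability_setT.
    rewrite -setXTT; apply: etrans (esym (prodE _ _ measurableT measurableT)).
    rewrite -[LHS]mule1.
    by congr (_ * _)%E; apply/esym; exact: probability_setT.
  rewrite (cell_fiber p_pr) //; transitivity (((p ^ n.+1) ^ k.+1)%:R^-1%:E : \bar R).
    exact: haar_redp.
  rewrite redp_fiber; apply: etrans (esym (prodE _ _ _ _)).
  + rewrite expnS natrM invfM EFinM; congr (_ * _)%E; apply/esym.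
      exact: haar_red.
    exact: haar_redv.
  + exact: measurable_red.
  + exact: measurable_redv.
- by move=> _; apply: (@le_lt_trans _ _ 1%E); rewrite ?ltry // probability_le1.
Qed.

End ProductHaar.

(** * Balls as residue classes *)

Section Balls.
Variables (R : realType) (p l k : nat).
Hypotheses (p_pr : prime p) (l_gt0 : (0 < l)%N).

Let p_gt0 : 0 < p%:R :> R. Proof. by rewrite ltr0n prime_gt0. Qed.

(** If x l is nonzero, then x n = 0 only for n < l, so the infimum is at least p^-(l-1) > p^-l. *)
Lemma padic_norm_le (x : padic_int p) :
  (padic_norm R x <= p%:R ^- l) = (x l == 0).
Proof.
have lb : has_lbound [set (p%:R ^- n : R) | n in [set n | x n = 0]].
  by exists 0 => _ [n _ <-]; rewrite invr_ge0 exprn_ge0 // ltW.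
apply/idP/eqP => [le|x0]; last by apply: ge_inf => //; exists l.
apply: contrapT => xl; move: le; apply/negP; rewrite -ltNge.
(* Residues modulo 1 are 0, so the infimum is over a nonempty set. *)
have x0 : x 0%N = 0 by rewrite -residue_small modz1.
apply: (@lt_le_trans _ _ (p%:R ^- l.-1)).
  rewrite ltf_pV2 ?posrE ?exprn_gt0 // ltr_eXn2l ?ltr1n ?prime_gt1 //.
  by rewrite prednK.
apply: lb_le_inf; first by exists (p%:R ^- 0); exists 0%N.
move=> _ [n /= xn <-]; rewrite lef_pV2 ?posrE ?exprn_gt0 //.
rewrite ler_eXn2l ?ltr1n ?prime_gt1 //.
rewrite -ltnS prednK // ltnNge; apply/negP => ln; apply: xl.
have zero i : (0 : padic_int p) i = 0 by exact: mod0z.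
by rewrite -(zero l); apply: residue_le ln _; rewrite xn zero.
Qed.

Lemma padic_ball_fiber (x : 'rV[padic_int p]_k) :
  padic_ball x (p%:R ^- l : R) = redv l @^-1` [set redv l x].
Proof.
have zero : (0 : padic_int p) l = 0 by exact: mod0z.
have eq_l (a b : padic_int p) : ((a - b) l == 0) = (a l == b l).
  have redN : red l (- b) = - red l b.
    apply: (addIr (red l b)); rewrite -(redD p_pr l_gt0) !addNr.
    by rewrite /red zero.
  apply/eqP/eqP => [ab|ab].
    apply/(red_eq p_pr l_gt0)/eqP; rewrite -subr_eq0 -redN -(redD p_pr l_gt0).
    by rewrite /red ab.
  rewrite -zero; apply/(red_eq p_pr l_gt0).
  by rewrite (redD p_pr l_gt0) redN /red ab zero subrr.
apply/seteqP; split => y.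
  move=> /bigmax_leP[_ yx]; apply/(redv_eq p_pr l_gt0) => i; apply/eqP.
  by rewrite -eq_l -padic_norm_le; have := yx i isT; rewrite !mxE.
move=> /(redv_eq p_pr l_gt0) yx; apply/bigmax_leP; split.
  by rewrite invr_ge0 exprn_ge0 // ltW.
by move=> i _; rewrite !mxE padic_norm_le eq_l; apply/eqP.
Qed.

End Balls.

(** * Integrals over residue classes and Jensen's inequality *)

Lemma tangent_exp (R : realDomainType) n (a b : R) : 0 <= a -> 0 <= b ->
  n.+1%:R * b ^+ n * a <= a ^+ n.+1 + n%:R * b ^+ n.+1.
Proof.
move=> a0 b0; elim: n => [|n IHn].
  by rewrite expr0 !mulr1 mul1r mul0r addr0.
(* The gap between the two sides for n + 1 is a times the gap for n plus (n+1) b^n (a - b)^2. *)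
have := ler_wpM2l a0 IHn; have : 0 <= n.+1%:R * b ^+ n * (a - b) ^+ 2.
  by rewrite mulr_ge0 ?sqr_ge0 // mulr_ge0 // exprn_ge0.
rewrite -!natr1 !exprS => H1 H2.
by rewrite -subr_ge0; move: H1 H2; rewrite -subr_ge0 => H1; rewrite -subr_ge0 => H2;
  apply: le_trans (addr_ge0 H1 H2) _; rewrite le_eqVlt; apply/orP; left; apply/eqP; ring.
Qed.

Section Cells.
Variables (R : realType) (p l k : nat).
Hypotheses (p_pr : prime p) (l_gt0 : (0 < l)%N).
Local Notation Zp := (padic_int p).
Local Notation Vp := 'rV[padic_int p]_k.
Local Notation Z := 'Z_(p ^ l).
Local Notation V := 'rV['Z_(p ^ l)]_k.
Local Notation N := (p ^ l)%N.
Variables (mu1 : probability Zp R) (mu : probability Vp R).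
Variable nu : probability (Zp * Vp)%type R.
Hypotheses (haar1 : normalized_haar mu1 +%R) (haar2 : normalized_haar mu +%R).
Hypothesis haar : normalized_haar nu +%R.
Variable g : Zp * Vp -> R.
Hypotheses (g_ge0 : forall x, 0 <= g x) (mg : measurable_fun setT g).
Local Open Scope ereal_scope.

Definition cell_integral (y : Z * V) : \bar R :=
  \int[nu]_(x in redp l @^-1` [set y]) (g x)%:E.

Lemma cell_integralE (c : Z) (b : V) : cell_integral (c, b) =
  \int[mu1]_(t in red l @^-1` [set c])
    \int[mu]_(z in redv l @^-1` [set b]) (g (t, z))%:E.
Proof.
set A := red l @^-1` _; set B := redv l @^-1` _.
have mA : measurable A by exact: measurable_red.
have mB : measurable B by exact: measurable_redv.
rewrite /cell_integral redp_fiber -/A -/B /=.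
rewrite (eq_measure_integral (mu1 \x mu)); last first.
  by move=> D mD _; exact: (haar_product p_pr haar1 haar2 haar).
rewrite integral_mkcond fubini_tonelli1.
- rewrite [RHS]integral_mkcond; apply: eq_integral => t _.
  rewrite /fubini_F !patchE; have [tA|tA] := boolP (t \in A).
    rewrite [RHS]integral_mkcond; apply: eq_integral => z _.
    by rewrite !patchE in_setX /= tA.
  by rewrite integral0_eq // => z _; rewrite patchE in_setX /= (negPf tA).
- apply/(measurable_restrictT _ _).1; first exact: measurableX.
  by apply: measurable_funS measurableT _ _ => //; exact/measurable_EFinP.
- by move=> x; apply: erestrict_ge0 => y _; rewrite lee_fin.
Qed.

Lemma measurable_slice_integral (b : V) :
  measurable_fun setT (fun t => \int[mu]_(z in redv l @^-1` [set b]) (g (t, z))%:E).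
Proof.
set B := redv l @^-1` _; have mB : measurable B by exact: measurable_redv.
have := @measurable_fun_fubini_tonelli_F _ _ Zp Vp R mu ((EFin \o g) \_ (setT `*` B)).
have -> : fubini_F mu ((EFin \o g) \_ (setT `*` B)) =
    fun t => \int[mu]_(z in B) (g (t, z))%:E.
  apply/funext => t; rewrite /fubini_F [RHS]integral_mkcond; apply: eq_integral => z _.
  by rewrite !patchE in_setX /= in_setT.
apply.
  apply/(measurable_restrictT _ _).1; first exact: measurableX.
  by apply: measurable_funS measurableT _ _ => //; exact/measurable_EFinP.
by move=> x; apply: erestrict_ge0 => y _; rewrite lee_fin.
Qed.

(** The ball about w + t u is a residue class that depends on t only modulo p^l, and delta^-k = N^k;
    grouping t by residues leaves the cells of a discrete line. *)
Lemma line_integral (w u : Vp) :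
  \int[mu1]_t (((p%:R ^- l) ^- k)%:E *
    \int[mu]_(z in padic_ball (w + t *: u)%R (p%:R ^- l : R)%R) (g (t, z))%:E) =
  (N ^ k)%:R%:E * \sum_(c : Z) cell_integral (c, redv l w + c *: redv l u)%R.
Proof.
pose h (c : Z) t := (N ^ k)%:R%:E *
  \int[mu]_(z in redv l @^-1` [set (redv l w + c *: redv l u)%R]) (g (t, z))%:E.
have h0 c t : 0 <= h c t.
  by rewrite mule_ge0 ?lee_fin // integral_ge0 // => z _; rewrite lee_fin.
have mh c : measurable_fun setT (h c).
  by apply: measurable_funeM; exact: measurable_slice_integral.
transitivity (\int[mu1]_t h (red l t) t).
  apply: eq_integral => t _; rewrite /h padic_ball_fiber // redvD // redvZ //.
  by rewrite exprVn invrK -exprM -natrX -expnM.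
rewrite (@integral_fibers _ _ _ _ _ (red l)) //; last first.
- exact: (measurable_fun_fibers (measurable_red p_pr l_gt0)).
- exact: measurable_red.
rewrite ge0_sume_distrr; last first.
  by move=> c _; apply: integral_ge0 => x _; rewrite lee_fin.
apply: eq_bigr => c _; rewrite cell_integralE.
transitivity (\int[mu1]_(t in red l @^-1` [set c]) h c t).
  by apply: eq_integral => t; rewrite inE => /= ->.
rewrite /h ge0_integralZl //.
- exact: measurable_red.
- by apply: measurable_funS measurableT _ _ => //; exact: measurable_slice_integral.
- by move=> t _; apply: integral_ge0 => z _; rewrite lee_fin.
Qed.

Definition cell_moment (y : Z * V) : \bar R :=
  \int[nu]_(x in redp l @^-1` [set y]) (g x ^+ k.+1)%:E.

Definition moment : \bar R := \int[nu]_x (g x ^+ k.+1)%:E.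

Let mgX : measurable_fun setT (fun x => (g x ^+ k.+1)%:E).
Proof. by apply/measurable_EFinP; exact: measurable_funX. Qed.

Let gX_ge0 x : 0 <= (g x ^+ k.+1)%:E. Proof. by rewrite lee_fin exprn_ge0. Qed.

Lemma momentE : moment = \sum_y cell_moment y.
Proof. by rewrite /moment (integral_fibers _ (measurable_redp p_pr l_gt0)). Qed.

Let cell_integral_ge0 y : 0 <= cell_integral y.
Proof. by apply: integral_ge0 => x _; rewrite lee_fin. Qed.

Lemma cell_tangent (a : R) y : (0 <= a)%R ->
  (k.+1%:R * a ^+ k)%:E * cell_integral y <=
  cell_moment y + (k%:R * a ^+ k.+1 * (N ^ k.+1)%:R^-1)%:E.
Proof.
move=> a0; have mc := measurable_redp p_pr l_gt0 y.
have mg' : measurable_fun (redp l @^-1` [set y]) (EFin \o g).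
  by apply: measurable_funS measurableT _ _ => //; exact/measurable_EFinP.
have mgX' : measurable_fun (redp l @^-1` [set y]) (fun x => (g x ^+ k.+1)%:E).
  exact: measurable_funS measurableT _ mgX.
rewrite [X in _ + X]EFinM -(haar_redp p_pr l_gt0 y haar) -integral_cst //.
rewrite /cell_moment -ge0_integralD //; last first.
  by move=> x _; rewrite lee_fin mulr_ge0 ?exprn_ge0.
rewrite /cell_integral -ge0_integralZl_EFin //.
- apply: ge0_le_integral => //.
  + by move=> x _; rewrite -EFinM lee_fin !mulr_ge0 ?exprn_ge0.
  + exact: measurable_funeM.
  + by apply: emeasurable_funD => //; exact: measurable_cst.
  + by move=> x _; rewrite -EFinM -EFinD lee_fin tangent_exp.
- by move=> x _; rewrite lee_fin.
- by rewrite mulr_ge0 ?exprn_ge0.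
Qed.

(** The tangent at 1 bounds the integral of g by that of g^(k+1) plus a constant. *)
Lemma cell_integral_fin y : cell_moment y < +oo -> cell_integral y \is a fin_num.
Proof.
move=> fin; rewrite ge0_fin_numE //; have := cell_tangent y ler01.
rewrite !expr1n mulr1; case: (cell_integral y) (cell_integral_ge0 y) => [r||] //=.
  by rewrite ltry.
rewrite mulry gtr0_sg ?ltr0n // mul1e => _; rewrite leye_eq => /eqP E.
have : cell_moment y + (k%:R * 1 * (N ^ k.+1)%:R^-1)%:E < +oo.
  by rewrite lte_add_pinfty ?ltry.
by rewrite E.
Qed.

(* Jensen's inequality, from the tangent at the mean value. *)
Lemma cell_jensen y : cell_moment y < +oo ->
  (fine (cell_integral y) ^+ k.+1 * (N ^ k.+1)%:R ^+ k)%:E <= cell_moment y.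
Proof.
move=> fin; have := cell_tangent y (a := (fine (cell_integral y) * (N ^ k.+1)%:R)%R).
have a0 := fine_ge0 (cell_integral_ge0 y).
have NN : ((N ^ k.+1)%:R != 0 :> R)%R.
  by rewrite pnatr_eq0 -lt0n !expn_gt0 prime_gt0.
rewrite -[in X in _ * X <= _](fineK (cell_integral_fin fin)).
have : 0 <= cell_moment y by apply: integral_ge0.
move: fin; case: (cell_moment y) => [P||] // _ _.
rewrite mulr_ge0 // => /(_ isT); rewrite -EFinM -EFinD !lee_fin.
set b := fine _ in a0 *; set M := (N ^ _)%:R%R in NN *.
have -> : (k%:R * (b * M) ^+ k.+1 / M = k%:R * (b ^+ k.+1 * M ^+ k))%R.
  by rewrite exprMn [(M ^+ k.+1)%R]exprSr -!mulrA mulfV // mulr1.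
have -> : (k.+1%:R * (b * M) ^+ k * b =
    (b ^+ k.+1 * M ^+ k) + k%:R * (b ^+ k.+1 * M ^+ k))%R.
  by rewrite exprMn exprSr -natr1; ring.
by rewrite lerD2r.
Qed.

(** The maximal function, as a function of the direction modulo p^l. *)
Definition kakeya_sup (v : V) : \bar R := ereal_sup [set (N ^ k)%:R%:E *
  \sum_(c : Z) cell_integral (c, redv l w + c *: v)%R | w in [set: Vp]].

Lemma kakeya_sup_ge0 v : 0 <= kakeya_sup v.
Proof.
apply: (@le_trans _ _ ((N ^ k)%:R%:E *
  \sum_(c : Z) cell_integral (c, redv l 0%R + c *: v)%R)).
  by rewrite mule_ge0 ?lee_fin ?sume_ge0.
by apply: ereal_sup_ubound; exists (0%R : Vp).
Qed.

Lemma kakeya_sup_moment : moment < +oo ->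
  \int[mu]_u (`|kakeya_sup (redv l u)| `^ k.+1%:R) <=
  (((k.+1 * p)%:R ^+ k.+1 + 1) * (l%:R + 1) ^+ (2 * k.+1))%:E * moment.
Proof.
move=> fin; set C := ((_ + _) * _)%R.
have cm0 y : 0 <= cell_moment y by apply: integral_ge0.
have cfin y : cell_moment y < +oo.
  by apply: le_lt_trans fin; rewrite momentE (bigD1 y) //= leeDl // sume_ge0.
pose F y := fine (cell_integral y).
have FE y : cell_integral y = (F y)%:E by rewrite fineK // cell_integral_fin.
have F0 y : (0 <= F y)%R by exact: fine_ge0.
(* Only finitely many residues of w matter, so the supremum is attained; [W] selects a maximizer for
   each direction, as [kakeya_maximal_discrete] requires. *)
have /choice[W WP] : forall v : V, exists w : V, forall w',
    (\sum_(c : Z) F (c, w' + c *: v)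
    <= \sum_(c : Z) F (c, w + c *: v))%R.
  move=> v; have [w _ wP] := @Order.TotalTheory.arg_maxP _ _ _ (0%R : V) xpredT
    (fun w => \sum_(c : Z) F (c, w + c *: v)%R)%R isT.
  by exists w => w'; exact: wP.
pose s v := (\sum_(c : Z) F (c, W v + c *: v))%R.
have supE v : kakeya_sup v <= ((N ^ k)%:R * s v)%:E.
  apply: ge_ereal_sup => _ [w _ <-]; under eq_bigr do rewrite FE.
  by rewrite sumEFin -EFinM lee_fin ler_wpM2l // WP.
rewrite (@integral_fiber_cst _ _ _ _ _ (redv l) _ (fun v => `|kakeya_sup v| `^ k.+1%:R)).
- apply: (@le_trans _ _ (\sum_v (((N ^ k)%:R * s v) ^+ k.+1 * (N ^ k)%:R^-1)%:E)).
    apply: lee_sum => v _.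
    rewrite [X in _ * X <= _](_ : _ = ((N ^ k)%:R^-1)%:E); last exact: haar_redv.
    rewrite EFinM lee_wpmul2r ?lee_fin //.
    rewrite -powR_mulrn ?mulr_ge0 ?sumr_ge0 // -poweR_EFin.
    have s0 : (0 <= s v)%R by rewrite sumr_ge0.
    rewrite gee0_abs ?kakeya_sup_ge0 //; apply: gt0_ler_poweR => //.
      by rewrite in_itv /= kakeya_sup_ge0 leey.
    by rewrite in_itv /= lee_fin mulr_ge0 //= leey.
  have Jtot : (((N ^ k.+1)%:R ^+ k * \sum_y F y ^+ k.+1)%:E <= moment).
    rewrite momentE mulr_sumr -sumEFin; apply: lee_sum => y _.
    by rewrite mulrC; exact: cell_jensen.
  have C0 : (0 <= C)%R by rewrite mulr_ge0 ?addr_ge0 ?exprn_ge0 ?addr_ge0.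
  apply: (@le_trans _ _ (C%:E *
      ((N ^ k.+1)%:R ^+ k * \sum_y F y ^+ k.+1)%:E)); last first.
    by apply: lee_wpmul2l; rewrite ?lee_fin.
  rewrite sumEFin -EFinM lee_fin -mulr_suml.
  have -> : (\sum_v ((N ^ k)%:R * s v) ^+ k.+1 =
      (N ^ k)%:R ^+ k.+1 * \sum_v s v ^+ k.+1)%R.
    by rewrite mulr_sumr; apply: eq_bigr => v _; rewrite exprMn.
  have D := kakeya_maximal_discrete p_pr l_gt0 F0 W.
  have NN : ((N ^ k)%:R != 0 :> R)%R by rewrite pnatr_eq0 -lt0n !expn_gt0 prime_gt0.
  rewrite ler_pdivrMr ?lt0r ?NN ?ler0n // -/C in D *.
  apply: le_trans (ler_wpM2l (exprn_ge0 k.+1 (ler0n R (N ^ k))) D) _.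
  (* The powers of N balance: (N^k)^(k+1) from the normalized lines against (N^(k+1))^k from
     Jensen. *)
  rewrite le_eqVlt; apply/orP; left; apply/eqP.
  have -> : ((N ^ k.+1)%:R ^+ k = (N ^ k)%:R ^+ k.+1 :> R)%R.
    by rewrite -!natrX -!expnM [(k.+1 * k)%N]mulnC.
  by rewrite -/C; ring.
- exact: measurable_redv.
- by move=> v; exact: poweR_ge0.
Qed.

End Cells.

(** * Complex-valued functions and L^m norms *)

Lemma measurable_cmod d (T : measurableType d) (R : realType) (f : T -> R[i]) :
  measurable_fun setT (fun x => complex.Re (f x)) ->
  measurable_fun setT (fun x => complex.Im (f x)) ->
  measurable_fun setT (fun x => cmod (f x)).
Proof.
move=> mRe mIm.
have -> : (fun x => cmod (f x)) =
    (fun x => Num.sqrt (complex.Re (f x) ^+ 2 + complex.Im (f x) ^+ 2)).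
  by apply/funext => x; rewrite /cmod /=; case: (f x).
apply: (measurableT_comp (continuous_measurable_fun (@sqrt_continuous R))).
by apply: measurable_funD; exact: measurable_funX.
Qed.

Lemma cmod_ge0 (R : realType) (z : R[i]) : 0 <= cmod z.
Proof. by rewrite /cmod; case: z => a b; exact: sqrtr_ge0. Qed.

(** The (k+1)-th root of [kakeya_sup_moment]; as C >= 1, the root of C is at most C. *)
Lemma kakeya_Lnorm_le (R : realType) (p l k : nat) (p_pr : prime p) (l_gt0 : (0 < l)%N)
    (mu1 : probability (padic_int p) R) (mu : probability 'rV[padic_int p]_k R)
    (nu : probability (padic_int p * 'rV[padic_int p]_k)%type R)
    (haar1 : normalized_haar mu1 +%R) (haar2 : normalized_haar mu +%R)
    (haar : normalized_haar nu +%R) (f : padic_int p * 'rV[padic_int p]_k -> R[i]) :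
  complex_Lfun nu k.+1%:R%:E f ->
  ('N[mu]_(k.+1%:R%:E) [@kakeya_maximal R p k.+1 mu1 mu (p%:R ^- l) f] <=
   (((k.+1 * p)%:R ^+ k.+1 + 1) * (l%:R + 1) ^+ 2)%:E *
     'N[nu]_(k.+1%:R%:E) [EFin \o (@cmod R \o f)])%E.
Proof.
move=> [LRe LIm]; pose g x := cmod (f x).
have g0 x : 0 <= g x by exact: cmod_ge0.
have mg : measurable_fun setT g.
  by apply: measurable_cmod; [have := sub_Lfun_mfun LRe|have := sub_Lfun_mfun LIm];
    rewrite inE.
have KE : @kakeya_maximal R p k.+1 mu1 mu (p%:R ^- l) f =1
    fun u => @kakeya_sup R p l k nu g (redv l u).
  move=> u; congr ereal_sup; apply/seteqP; split => _ [w _ <-]; exists w => //.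
    by apply/esym; exact: line_integral.
  exact: line_integral.
have k1 : k.+1%:R != 0 :> R by rewrite pnatr_eq0.
have normg : ('N[nu]_(k.+1%:R%:E) [EFin \o (@cmod R \o f)] =
    (@moment R p k nu g) `^ k.+1%:R^-1)%E.
  rewrite unlock; congr poweR; apply: eq_integral => x _ /=.
  by rewrite ger0_norm ?powR_mulrn //; exact: cmod_ge0.
rewrite (funext KE) normg.
set C := _ + 1; have C1 : 1 <= C by rewrite lerDr exprn_ge0.
have C0 : 0 < C by exact: lt_le_trans ltr01 C1.
have l0 : 0 < l%:R + 1 :> R by rewrite natr1.
have M0 : (0 <= @moment R p k nu g)%E.
  by apply: integral_ge0 => x _; rewrite lee_fin exprn_ge0.
have [fin|] := ltP (@moment R p k nu g) +oo%E; last first.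
  rewrite leye_eq => /eqP ->; rewrite poweRyr ?invr_eq0 //.
  by rewrite gt0_muley ?leey // lte_fin mulr_gt0 // exprn_gt0.
have K := kakeya_sup_moment p_pr l_gt0 haar2 haar g0 mg fin.
rewrite unlock -/C in K *.
apply: (@le_trans _ _ (((C * (l%:R + 1) ^+ (2 * k.+1))%:E *
    @moment R p k nu g) `^ k.+1%:R^-1)%E).
  apply: gt0_ler_poweR K; rewrite ?in_itv /= ?andbT ?leey ?invr_ge0 //.
    by rewrite integral_ge0 // => u _; exact: poweR_ge0.
  by rewrite mule_ge0 // lee_fin mulr_ge0 ?exprn_ge0 // ltW.
rewrite poweRM //; last by rewrite lee_fin mulr_ge0 ?exprn_ge0 // ltW.
apply: lee_wpmul2r; first exact: poweR_ge0.
rewrite poweR_EFin lee_fin.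
have Cl0 : 0 <= C * (l%:R + 1) ^+ 2 by rewrite mulr_ge0 ?exprn_ge0 // ltW.
have -> : C * (l%:R + 1) ^+ 2 = ((C * (l%:R + 1) ^+ 2) ^+ k.+1) `^ k.+1%:R^-1.
  by rewrite -[X in X `^ _]powR_mulrn // -powRrM mulfV // powRr1.
apply: ge0_ler_powR; rewrite ?invr_ge0 ?nnegrE ?exprn_ge0 //.
  by rewrite mulr_ge0 ?exprn_ge0 // ltW.
rewrite exprMn -exprM ler_wpM2r ?exprn_ge0 ?(ltW l0) //.
by rewrite ler_eXnr.
Qed.

(** With a = eps ln q the power is exp(a l). Its square root is at least 1 + a l / 2, and
    multiplying by 1 + 2 / a gives at least l + 1. *)
Lemma sqr_le_powR (R : realType) (q eps : R) : 1 < q -> 0 < eps ->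
  exists2 K : R, 0 <= K & forall l : nat, (l%:R + 1) ^+ 2 <= K * (q ^- l) `^ (- eps).
Proof.
move=> q1 eps0; have q0 : 0 < q by exact: lt_trans q1.
pose a := eps * ln q; have a0 : 0 < a by rewrite mulr_gt0 // ln_gt0.
exists ((1 + 2 / a) ^+ 2); first exact: sqr_ge0.
move=> l.
have -> : (q ^- l) `^ (- eps) = expR (a * l%:R / 2) ^+ 2.
  rewrite /powR invr_eq0 expf_eq0 (gt_eqF q0) andbF lnV ?posrE ?exprn_gt0 // lnXn //.
  rewrite -expRM_natr; congr expR.
  by rewrite mulrNN /a -[ln q *+ l]mulr_natr; field.
have a2 : 0 <= 2 / a by rewrite divr_ge0 // ltW.
rewrite -exprMn lerXn2r ?nnegrE ?addr_ge0 ?mulr_ge0 ?addr_ge0 ?expR_ge0 //.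
apply: (@le_trans _ _ ((1 + 2 / a) * (1 + a * l%:R / 2))).
  have -> : (1 + 2 / a) * (1 + a * l%:R / 2) = (l%:R + 1) + (2 / a + a * l%:R / 2).
    by field; rewrite gt_eqF.
  by rewrite lerDl addr_ge0 // divr_ge0 // mulr_ge0 // ltW.
by rewrite ler_wpM2l ?expR_ge1Dx // addr_ge0.
Qed.

Theorem lemma4p3 (R : realType) (p : nat) (p_prime : prime p)
    (mu1 : probability (padic_int p) R)
    (mu : forall k : nat, probability 'rV[padic_int p]_k R)
    (nu : forall m : nat, probability (padic_space p m) R)
    (mu1_haar : normalized_haar mu1 +%R)
    (mu_haar : forall k : nat, normalized_haar (mu k) +%R)
    (nu_haar : forall m : nat, normalized_haar (nu m) +%R) :
  (forall m : nat, (2 <= m)%N ->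
    exists C : R, forall (l : nat) (f : padic_space p m -> R[i]),
      (1 <= l)%N -> complex_Lfun (nu m) m%:R%:E f ->
      ('N[mu m.-1]_(m%:R%:E) [kakeya_maximal mu1 (mu m.-1) (p%:R ^- l) f] <=
        (C * (l%:R + 1) ^+ 2)%:E *
          'N[nu m]_(m%:R%:E) [EFin \o (@cmod R \o f)])%E) /\
  (forall m : nat, (2 <= m)%N -> forall eps : R, 0 < eps ->
    exists C : R, forall (l : nat) (f : padic_space p m -> R[i]),
      (1 <= l)%N -> complex_Lfun (nu m) m%:R%:E f ->
      ('N[mu m.-1]_(m%:R%:E) [kakeya_maximal mu1 (mu m.-1) (p%:R ^- l) f] <=
        (C * (p%:R ^- l) `^ (- eps))%:E *
          'N[nu m]_(m%:R%:E) [EFin \o (@cmod R \o f)])%E).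
Proof.
split => [[//|k] _|[//|k] _ eps eps0].
  exists ((k.+1 * p)%:R ^+ k.+1 + 1) => l f l1 Lf.
  exact: kakeya_Lnorm_le.
have [|K K0 KP] := sqr_le_powR _ eps0 (q := p%:R); first by rewrite ltr1n prime_gt1.
exists (((k.+1 * p)%:R ^+ k.+1 + 1) * K) => l f l1 Lf.
apply: (@le_trans _ _ _ _ _
  (kakeya_Lnorm_le p_prime l1 mu1_haar (mu_haar k) (nu_haar k.+1) Lf)).
apply: lee_wpmul2r; first exact: Lnorm_ge0.
by rewrite lee_fin -mulrA ler_wpM2l // addr_ge0 // exprn_ge0.
Qed.
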